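(* Let $s \in \mathbb{N}$ and let $q$ be a prime number. For $\mu_s$-almost all $\boldsymbol{f}=(f_1,\ldots,f_s) \in (\overline{\mathbb{Z}}_q((x^{-1})))^s$ the digital Kronecker-sequence $\mathcal{S}(\boldsymbol{f})$ satisfies $$D_N^\ast(\mathcal{S}(\boldsymbol{f})) \ge c(q,s)\, (\log N)^s \log\log N \quad \text{for infinitely many } N \in \mathbb{N},$$ where $c(q,s)>0$ depends only on $q$ and $s$ (and not on $N$).
   Context: $\mathbb{Z}_q$ is the finite field $\{0,1,\ldots,q-1\}$ with arithmetic modulo $q$, $\mathbb{Z}_q[x]$ the polynomial ring and $\mathbb{Z}_q((x^{-1}))$ the field of formal Laurent series $g=\sum_{k=w}^\infty a_k x^{-k}$ ($a_k\in\mathbb{Z}_q$, $w\in\mathbb{Z}$). The fractional part is $\{g\}=\sum_{k\ge \max(1,w)} a_k x^{-k}$. $\overline{\mathbb{Z}}_q((x^{-1}))$ denotes the set of series of the form $\sum_{k=1}^\infty a_k x^{-k}$. A nonnegative integer $n=n_0+n_1q+\cdots+n_rq^r$ (base $q$ digits) is identified with the polynomial $n(x)=n_0+n_1x+\cdots+n_rx^r$. For $\boldsymbol{f}=(f_1,\ldots,f_s)$ the digital Kronecker-sequence $\mathcal{S}(\boldsymbol{f})=(\boldsymbol{x}_n)_{n\ge0}$ in $[0,1)^s$ is given by $\boldsymbol{x}_n=(\{n(x)f_1(x)\}|_{x=q},\ldots,\{n(x)f_s(x)\}|_{x=q})$, i.e. a series $\sum_{k\ge1}t_kx^{-k}$ is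 evaluated as the real number $\sum_{k\ge 1} t_k q^{-k}$. $\mu$ is the normalized Haar measure on $\overline{\mathbb{Z}}_q((x^{-1}))$ (the measure for which the set of series whose first $m$ coefficients $a_1,\ldots,a_m$ are prescribed has measure $q^{-m}$; equivalently Lebesgue measure under the identification with $[0,1)$ via $x\mapsto q$), and $\mu_s$ is its $s$-fold product measure. For a sequence $(\boldsymbol{y}_n)_{n\ge0}$ in $[0,1)^s$ and $N\in\mathbb{N}$, the (unnormalized) star discrepancy is $D_N^\ast=\sup_{\boldsymbol{x}\in[0,1]^s}\left|\#\{0\le n<N: \boldsymbol{y}_n\in\prod_{j=1}^s[0,x_j)\}-Nx_1\cdots x_s\right|$. *)

(* Defs.v *)
From HB Require Import structures.
From mathcomp Require Import all_boot all_order all_algebra.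
From mathcomp Require Import all_classical all_reals all_analysis.
From mathcomp Require Import measurable_realfun.
Set Implicit Arguments.
Unset Strict Implicit.
Unset Printing Implicit Defensive.
Import Order.TTheory GRing.Theory Num.Theory.
Import numFieldNormedType.Exports.
Local Open Scope classical_set_scope.
Local Open Scope ring_scope.

(* [laurent_coef g k] is the coefficient of x^{-k}: only finitely many positive
   powers of x occur. *)
Record laurent (F : nzRingType) := Laurent {
  laurent_coef : int -> F;
  laurent_order : exists w : int, forall k, k < w -> laurent_coef k = 0 }.

Section Laurent.
Variable F : nzRingType.

Lemma laurent_mul_subproof (g h : laurent F) :
  exists w : int, forall k, k < w ->
    \sum_(i \in [set: int]) laurent_coef g i * laurent_coef h (k - i) = 0.
Proof.
have [[w1 h1] [w2 h2]] := (laurent_order g, laurent_order h).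
exists (w1 + w2) => k kw; apply: fsbig1 => i _.
have [iw|iw] := ltP i w1; first by rewrite h1// mul0r.
by rewrite h2 ?mulr0// ltrBlDr addrC (lt_le_trans kw)// lerD2r.
Qed.

(* The family summed over i has finite support, so the finitely supported sum
   is the genuine Cauchy product. *)
Definition laurent_mul (g h : laurent F) : laurent F :=
  Laurent (laurent_mul_subproof g h).

Lemma laurent_poly_subproof (p : {poly F}) :
  exists w : int, forall k, k < w ->
    (if k <= 0 then p`_`|k|%N else 0) = 0.
Proof.
exists (- (size p)%:Z) => k kw; case: ifPn => // k0.
apply: nth_default; rewrite -lez_nat abszE ler0_norm// lerNr.
exact: ltW.
Qed.

Definition laurent_poly (p : {poly F}) : laurent F :=
  Laurent (laurent_poly_subproof p).

Lemma laurent_frac_subproof (t : nat -> F) :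
  exists w : int, forall k, k < w ->
    (if k is Posz j.+1 then t j else 0) = 0.
Proof. by exists 0 => -[]. Qed.

(* A series sum_{k >= 1} a_k x^{-k} is stored as the sequence a_1, a_2, ...
   indexed from 0, i.e. [t k] is the coefficient of x^{-(k+1)}. *)
Definition laurent_frac (t : nat -> F) : laurent F :=
  Laurent (laurent_frac_subproof t).

Definition frac_part (g : laurent F) : nat -> F :=
  fun k => laurent_coef g k.+1%:Z.

End Laurent.

(* The bound i < n is enough since n < q ^ n for 2 <= q. *)
Definition nat_poly (q n : nat) : {poly 'F_q} :=
  \poly_(i < n) ((n %/ q ^ i) %% q)%N%:R.

(* Evaluation at x = q, with the index shift of [laurent_frac]. *)
Definition eval_frac (R : realType) (q : nat) (t : nat -> 'F_q) : R :=
  limn (series (fun k => (t k : nat)%:R / q%:R ^+ k.+1 : R)).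

HB.instance Definition _ n := isPointed.Build 'I_n.+1 ord0.

Definition coord_sets (q : nat) : set (set (nat -> 'F_q)) :=
  [set A | exists k a, A = [set f | f k = a]].

Arguments coord_sets : clear implicits.

(* The series sum_{k >= 1} a_k x^{-k} over Z_q, with the product
   sigma-algebra. *)
Notation fseries q := (g_sigma_algebraType (coord_sets q)).

Definition digital_kronecker (R : realType) (q s : nat)
    (f : s.-tuple (fseries q)) (n : nat) (j : 'I_s) : R :=
  eval_frac R (frac_part
    (laurent_mul (laurent_poly (nat_poly q n)) (laurent_frac (tnth f j)))).

Definition star_discrepancy (R : realType) (s : nat) (y : nat -> 'I_s -> R)
    (N : nat) : R :=
  sup [set `|#|[pred n : 'I_N | [forall j, 0 <= y n j < x j]]|%:R
             - N%:R * \prod_(j < s) x j|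
      | x in [set x : 'I_s -> R | forall j, 0 <= x j <= 1]].

Section Haar.
Variables (R : realType) (q : nat).

(* The cast to 'F_q reduces modulo q, so for 0 <= x < 1 this is the sequence of
   base q digits of x. *)
Definition digits (x : measurableTypeR R) : fseries q :=
  fun k => (Num.truncn ((x : R) * q%:R ^+ k.+1))%:R.

Lemma measurable_digits : measurable_fun setT digits.
Proof.
apply: (@measurability _ _ R (fseries q) setT digits (coord_sets q)) => // _ [_ [k [a ->]] <-].
rewrite setTI (_ : _ @^-1` _ = \bigcup_(n in [set n | n%:R = a])
    ((fun x => (Num.truncn x)%:R) \o (fun x => x * q%:R ^+ k.+1))
      @^-1` [set n%:R : R]); last first.
  apply/seteqP; split => x /=; first by exists (Num.truncn (x * q%:R ^+ k.+1)).
  by move=> [n /= <- /eqP]; rewrite eqr_nat /digits => /eqP ->.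
apply: bigcup_measurable => n _; rewrite -[X in measurable X]setTI.
apply: (@measurable_comp _ _ _ R R R setT) => //.
  apply: nondecreasing_measurable => // x y xy.
  by rewrite ler_nat le_truncn.
exact: mulrr_measurable.
Qed.

HB.instance Definition _ :=
  isMeasurableFun.Build _ _ _ _ digits measurable_digits.

(* Lebesgue measure on [0, 1] transported along the base q expansion;
   [haar_cylinder] below gives the usual characterization for q prime. *)
Definition haar : probability (fseries q) R :=
  distribution (uniform_prob (@ltr01 R)) digits.

Definition cons_fseries s (u : fseries q * s.-tuple (fseries q)) :
  s.+1.-tuple (fseries q) := [the _.-tuple _ of u.1 :: u.2].

Lemma measurable_cons_fseries s : measurable_fun setT (@cons_fseries s).
Proof. exact: measurable_cons. Qed.

HB.instance Definition _ s :=
  isMeasurableFun.Build _ _ _ _ (@cons_fseries s) (@measurable_cons_fseries s).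

(* The s-fold product measure, see [haar_prodE]. *)
Fixpoint haar_prod (s : nat) : probability (s.-tuple (fseries q)) R :=
  if s is s'.+1 then
    distribution (haar \x haar_prod s')%E (@cons_fseries s')
  else dirac [tuple].

Lemma measurable_box s (A : 'I_s -> set (fseries q)) :
  (forall j, measurable (A j)) ->
  measurable [set f : s.-tuple (fseries q) | forall j, A j (tnth f j)].
Proof.
move=> mA; rewrite (_ : [set _ | _] =
  \bigcap_(j in [set: 'I_s]) ((@tnth _ _ ^~ j) @^-1` A j)).
  apply: fin_bigcap_measurable => // j _ /=.
  rewrite -[X in measurable X]setTI.
  exact: (@measurable_tnth _ (fseries q) s j measurableT (A j) (mA j)).
by apply/seteqP; split => f /= fA j; [move=> _; exact: fA|exact: fA].
Qed.

Lemma haar_prodE s (A : 'I_s -> set (fseries q)) :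
  (forall j, measurable (A j)) ->
  haar_prod s [set f | forall j, A j (tnth f j)] =
  (\prod_(j < s) haar (A j))%E.
Proof.
elim: s A => [|s IH] A mA.
  by rewrite big_ord0 /= diracE mem_set// => -[].
have mA' j : measurable (A (lift ord0 j)) by exact: mA.
have mbox := measurable_box mA'.
rewrite big_ord_recl -(IH _ mA') -(product_measure1E _ _ (mA ord0) mbox).
rewrite [LHS]/= /distribution /pushforward; congr (_ _).
apply/seteqP; split => -[g f] /=.
  move=> gfA; split => [|j] /=; first exact: (gfA ord0).
  by have := gfA (lift ord0 j); rewrite /cons_fseries /= tnthS.
move=> [gA fA] j; case: (unliftP ord0 j) => [i ->|->] //.
by rewrite /cons_fseries tnthS.
Qed.

Lemma digits_cylinder (m : nat) (a : nat -> 'F_q) : prime q ->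
  exists2 A : nat, (A < q ^ m)%N & forall x : R, 0 <= x ->
    (Num.truncn x = 0%N /\ forall k, (k < m)%N -> digits x k = a k) <->
    Num.truncn (x * q%:R ^+ m) = A.
Proof.
move=> pq; have q0 := prime_gt0 pq; elim: m => [|m [A Am IH]].
  exists 0%N; first by rewrite expn0.
  move=> x _; rewrite expr0 mulr1; split=> [[]//|->]; split=> //.
have aq (y : 'F_q) : (y < q)%N by rewrite -[ltnRHS](Fp_cast pq).
have step (x : R) : 0 <= x -> Num.truncn (x * q%:R ^+ m) =
    (Num.truncn (x * q%:R ^+ m.+1) %/ q)%N.
  move=> x0; set y := x * q%:R ^+ m.+1.
  have q0R : 0 < q%:R :> R by rewrite ltr0n.
  have y0 : 0 <= y by rewrite mulr_ge0// exprn_ge0// ler0n.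
  have xy : x * q%:R ^+ m = y / q%:R by rewrite /y exprSr mulrA mulfK// gt_eqF.
  apply: truncn_def; rewrite xy ler_pdivlMr// ltr_pdivrMr// -!natrM.
  rewrite -truncn_ge_nat// -truncn_lt_nat// leq_divM/=.
  by rewrite -ltn_divLR.
exists (A * q + a m)%N.
  by rewrite expnSr (@leq_trans (A * q + q)%N) ?ltn_add2l// -mulSnr leq_mul2r Am orbT.
move=> x x0; have {}IH := IH x x0; have {}step := step x x0.
have digE : (digits x m == a m) = (Num.truncn (x * q%:R ^+ m.+1) %% q == a m)%N.
  rewrite -val_eqE /= /digits val_Fp_nat//.
split.
  move=> [tx xa]; have /IH : Num.truncn x = 0%N /\
      forall k, (k < m)%N -> digits x k = a k.
    by split => // k km; apply: xa; rewrite ltnS ltnW.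
  move: (xa m (ltnSn m)) => /eqP; rewrite digE => /eqP <- <-.
  by rewrite step -divn_eq.
move=> tA; have : Num.truncn (x * q%:R ^+ m) = A.
  by rewrite step tA divnMDl// divn_small ?addn0.
move=> /IH[tx xa]; split=> // k; rewrite ltnS leq_eqVlt => /orP[/eqP ->|/xa//].
by apply/eqP; rewrite digE tA modnMDl modn_small.
Qed.

Lemma measurable_cylinder (m : nat) (a : nat -> 'F_q) :
  measurable ([set f | forall k, (k < m)%N -> f k = a k] : set (fseries q)).
Proof.
rewrite (_ : [set _ | _] =
  \bigcap_(k in `I_m) ([set f | f k = a k] : set (fseries q))) //.
apply: fin_bigcap_measurable => // k _.
by apply: sub_sigma_algebra; exists k, (a k).
Qed.

Lemma haar_cylinder (m : nat) (a : nat -> 'F_q) : prime q ->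
  haar [set f | forall k, (k < m)%N -> f k = a k] = (q%:R ^- m)%:E.
Proof.
move=> pq; have [A Am AE] := digits_cylinder m a pq.
have qm0 : 0 < q%:R ^+ m :> R by rewrite exprn_gt0// ltr0n prime_gt0.
rewrite [LHS]/= /distribution /pushforward /uniform_prob integral_uniform_pdf.
set C := _ @^-1` _.
have mC : measurable C.
  rewrite -[X in measurable X]setTI.
  exact: (measurable_digits measurableT (measurable_cylinder m a)).
have mC1 : measurable (C `&` `[0, 1]) by exact: measurableI.
rewrite (eq_integral (cst 1%:E)); last first.
  move=> x; rewrite inE/= => -[_]; rewrite in_itv/= /uniform_pdf => ->.
  by rewrite subr0 invr1.
rewrite integral_cst//= mul1e (measureDI _ mC1 (measurable_set1 (1 : R))).
set I := `[A%:R / q%:R ^+ m, A.+1%:R / q%:R ^+ m[%classic : set R.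
have CI : (C `&` `[0, 1]) `\ (1 : R) = I.
  apply/seteqP; split => x; rewrite /I /= !in_itv/=.
    move=> [[Cx /andP[x0 x1]] /eqP x1']; have {x1'}x1 : x < 1 by rewrite lt_neqAle x1' x1.
    have <- : Num.truncn (x * q%:R ^+ m) = A.
      by apply/AE => //; split=> //; apply: truncn_def; rewrite x0 x1.
    rewrite ler_pdivrMr// ltr_pdivlMr// truncn_itv//.
    by rewrite mulr_ge0// ltW.
  move=> /andP[Ax xA].
  have x0 : 0 <= x by rewrite (le_trans _ Ax)// divr_ge0// ltW.
  have x1 : x < 1.
    rewrite (lt_le_trans xA)// ler_pdivrMr// mul1r -natrX ler_nat.
    exact: Am.
  move: Ax xA; rewrite ler_pdivrMr// ltr_pdivlMr// => Ax xA.
  have [_ Cx] : Num.truncn x = 0%N /\ forall k, (k < m)%N -> digits x k = a k.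
    by apply/AE => //; apply: truncn_def; rewrite Ax xA.
  split; first by split => //; rewrite x0 ltW.
  by apply/eqP; rewrite lt_eqF.
rewrite [X in (_ + X)%E](_ : _ = 0%E); last first.
  have m1 := measurable_set1 (1 : R).
  apply: (subset_measure0 (measurableI _ _ mC1 m1) m1) => //.
  exact: lebesgue_measure_set1.
rewrite adde0 CI; apply: (etrans (lebesgue_measure_itv _)).
rewrite /= lte_fin ltr_pM2r ?invr_gt0// ltr_nat ltnSn.
by rewrite -EFinB -mulrBl -natrB// subSnn mul1r.
Qed.

End Haar.

(* Main.v *)
Require Import Defs.
From HB Require Import structures.
From mathcomp Require Import all_boot all_order all_algebra all_field.
From mathcomp Require Import all_classical all_reals all_analysis.
From mathcomp Require Import zify ring lra.
Set Implicit Arguments.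
Unset Strict Implicit.
Unset Printing Implicit Defensive.
Import Order.TTheory GRing.Theory Num.Theory.
Import numFieldNormedType.Exports.
Local Open Scope classical_set_scope.
Local Open Scope ring_scope.

(* Idea. Multiplicative Khinchin theorem with divergent weights: almost surely
   there are infinitely many vectors [k] of monic polynomials such that the
   first [m] coefficients of the fractional part of [k_1 f_1 + ... + k_s f_s]
   vanish, where [q ^ m] exceeds [q ^ (sum of the sizes of the k_i)] by a factor
   of order [m ^ s * log m]. Such a [k] is a linear relation over [Z_q] between
   the digits of each of the first [q ^ m] points, so that some elementary-like
   box of volume of order [q ^ - (sum of the sizes)] contains none of them.

   The approximations are produced by a second moment argument on finite blocks
   of coefficients. If [s >= 2] the events attached to distinct monic [k] with
   [k_1] and [k_2] coprime are pairwise independent. If [s = 1] all [k] are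
   dependent, and one counts instead the degrees of convergents followed by a
   large partial quotient, read off from Hankel forms. Each block succeeds with
   probability at least 1/8 whatever the preceding coefficients are: replacing
   [k] by [x ^ M k] ignores the first [M] coefficients of [f], at the price of a
   constant factor that does not affect divergence. *)

(** * Counting and pairing *)

Section Counting.
Implicit Types (T : finType).

(** The maps [sigma b] are injective, preserve [Q] and shift [h] by [b], so all fibres of [h] inside
    [Q] have the same size. *)
Lemma card_equidistributed T (V : finZmodType) (h : T -> V)
    (sigma : V -> T -> T) (Q : pred T) :
  (forall b x, h (sigma b x) = h x + b) ->
  (forall b x, Q (sigma b x) = Q x) ->
  (forall b, injective (sigma b)) ->
  #|[pred x | Q x]| = (#|[pred x | Q x && (h x == 0%R)]| * #|V|)%N.
Proof.
move=> hs Qs sI.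
rewrite -sum1_card (partition_big h predT)//= (eq_bigr (fun=> #|[pred x | Q x && (h x == 0%R)]|)).
  by rewrite big_const iter_addn_0.
move=> b _; rewrite sum1_card -[LHS]/#|[pred x | Q x && (h x == b)]|.
pose g := sigma (- b).
have gI : injective g by exact: sI.
rewrite -[LHS](fintype.card_image gI [pred x | Q x && (h x == b)]).
have gbij : bijective g by exact: injF_bij.
have [g' gK g'K] := gbij.
apply: eq_card => y; rewrite !inE -[y]g'K.
rewrite (fintype.mem_image gI) unfold_in /= /g Qs hs.
by rewrite subr_eq0.
Qed.

(** Paley-Zygmund bound for the number [X] of events that occur: its mean is at least [c S] and, as
    [S >= 1], its second moment is at most [S + S ^ 2 <= 2 S ^ 2], however large [S] is. *)
Lemma second_moment (R : realFieldType) T (I : finType) (P : pred I)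
    (A : I -> pred T) (w : I -> R) (c : R) :
  0 < c -> (forall i, P i -> 0 <= w i) -> 1 <= \sum_(i | P i) w i ->
  (forall i, P i -> c * w i * #|T|%:R <= #|A i|%:R <= w i * #|T|%:R) ->
  (forall i j, P i -> P j -> i != j ->
     #|[pred x | A i x && A j x]|%:R <= w i * w j * #|T|%:R) ->
  c ^+ 2 / 2%:R * #|T|%:R <= #|[pred x | [exists i, P i && A i x]]|%:R.
Proof.
move=> c0 w0; set S := \sum_(i | P i) w i => S1 Aw AA.
have S0 : 0 < S by lra.
pose X x : R := \sum_(i | P i) (A i x)%:R.
(* This value maximises [2 t c S - 2 t ^ 2 S ^ 2], with maximum [c ^ 2 / 2]. *)
pose t := c / (2%:R * S).
have cardE (B : pred T) : #|B|%:R = \sum_x (B x)%:R :> R.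
  by rewrite -sum1_card natr_sum big_mkcond; apply: eq_bigr => x _; rewrite unfold_in; case: (B x).
have X0 : \sum_x X x >= c * S * #|T|%:R.
  rewrite exchange_big /= mulr_sumr mulr_suml; apply: ler_sum => i Pi.
  by rewrite -cardE; case/andP: (Aw i Pi).
have X2 : \sum_x X x ^+ 2 <= 2%:R * S ^+ 2 * #|T|%:R.
  have -> : \sum_x X x ^+ 2 = \sum_(i | P i) \sum_(j | P j) #|[pred x | A i x && A j x]|%:R.
    under eq_bigr do rewrite expr2 /X big_distrlr /=.
    rewrite exchange_big; apply: eq_bigr => i _ /=.
    rewrite exchange_big; apply: eq_bigr => j _ /=.
    by rewrite cardE; apply: eq_bigr => x _; rewrite /= -natrM mulnb.
  apply: (@le_trans _ _ (\sum_(i | P i) (w i + w i * S) * #|T|%:R)).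
    apply: ler_sum => i Pi; rewrite (bigD1 i)//= mulrDl; apply: lerD.
      have -> : #|[pred x | A i x && A i x]| = #|A i| by apply: eq_card => x; exact: andbb.
      by case/andP: (Aw i Pi).
    rewrite -mulrA mulr_suml mulr_sumr [leRHS](bigD1 i)//=.
    apply: ler_wpDl; first by rewrite !mulr_ge0// ?ler0n ?w0.
    apply: ler_sum => j /andP[Pj ij]; rewrite mulrA.
    by apply: AA; rewrite // eq_sym.
  rewrite -mulr_suml big_split /= -mulr_suml -/S; apply: ler_wpM2r => //.
  by rewrite expr2; nra.
(* [1_(X > 0) >= 2 t X - t ^ 2 X ^ 2], since [(1 - t X) ^ 2 >= 0]. *)
have key x : 2%:R * t * X x - t ^+ 2 * X x ^+ 2 <= ([pred x | [exists i, P i && A i x]] x)%:R.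
  rewrite /=; case: existsP => [_|nE].
    have : 0 <= (1 - t * X x) ^+ 2 by exact: sqr_ge0.
    by rewrite sqrrB expr1n mul1r exprMn /=; set a := t * X x => ?; rewrite -mulrA -/a; lra.
  rewrite (_ : X x = 0) ?expr0n /= ?mulr0 ?subr0//.
  apply: big1 => i Pi; case Ai : (A i x) => //.
  by case: nE; exists i; rewrite Pi Ai.
rewrite [leRHS]cardE; apply: (@le_trans _ _
  (\sum_x (2%:R * t * X x - t ^+ 2 * X x ^+ 2))); last by apply: ler_sum => x _; exact: key.
rewrite sumrB -!mulr_sumr.
have t0 : 0 <= t by rewrite /t divr_ge0//; lra.
have h1 := ler_wpM2l (mulr_ge0 (ler0n R 2) t0) X0.
have h2 := ler_wpM2l (sqr_ge0 t) X2.
have e1 : 2%:R * t * (c * S * #|T|%:R) = c ^+ 2 * #|T|%:R.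
  by rewrite /t; field; rewrite gt_eqF.
have e2 : t ^+ 2 * (2%:R * S ^+ 2 * #|T|%:R) = c ^+ 2 / 2%:R * #|T|%:R.
  by rewrite /t; field; rewrite gt_eqF.
rewrite e1 in h1; rewrite e2 in h2; lra.
Qed.

End Counting.

Section Pairing.
Variable F : fieldType.
Implicit Types (u : nat -> F) (p : {poly F}).

(** The coefficient of x^{-1} in the product of [p] with the series of coefficients [u]; multiplying
    [p] by ['X^j] reads off the coefficient of x^{-(j+1)}. *)
Definition pairing u p : F := \sum_(t < size p) p`_t * u t.

Lemma pairing_widen n u p : (size p <= n)%N ->
  pairing u p = \sum_(t < n) p`_t * u t.
Proof.
move=> pn; rewrite /pairing (big_ord_widen n (fun t => p`_t * u t) pn) big_mkcond /=.
apply: eq_bigr => t _; case: ltnP => // tp.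
by rewrite nth_default ?mul0r.
Qed.

Lemma pairing_is_linear u : linear_for *%R (pairing u).
Proof.
move=> a p r; set n := maxn (size p) (size r).
rewrite (@pairing_widen n _ (_ + _)); last first.
  by rewrite (leq_trans (size_polyD _ _))// geq_max leq_maxr andbT
    (leq_trans (size_scale_leq _ _))// leq_maxl.
rewrite (@pairing_widen n _ p) ?leq_maxl// (@pairing_widen n _ r) ?leq_maxr//.
rewrite mulr_sumr -big_split; apply: eq_bigr => t _ /=.
by rewrite coefD coefZ mulrDl mulrA.
Qed.

HB.instance Definition _ u :=
  GRing.isLinear.Build F {poly F} F *%R (pairing u) (pairing_is_linear u).

Lemma pairing_eq n u u' p : (forall t, (t < n)%N -> u t = u' t) ->
  (size p <= n)%N -> pairing u p = pairing u' p.
Proof.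
move=> uu' pn; apply: eq_bigr => t _; rewrite uu'//.
exact: leq_trans (ltn_ord t) pn.
Qed.

(** Multiplication by ['X^M] hides the first [M] coefficients, so that later blocks can be treated
    like the first one. *)
Lemma pairing_shift M u p : pairing (fun t => u (M + t)%N) p = pairing u ('X^M * p).
Proof.
rewrite mulrC [RHS](@pairing_widen (M + size p)); last first.
  by rewrite (leq_trans (size_polyMleq _ _))// size_polyXn addnS addnC.
rewrite big_split_ord /= big1 ?add0r; last first.
  by move=> i _; rewrite coefMXn ltn_ord mul0r.
apply: eq_bigr => t _; rewrite coefMXn ltnNge leq_addr /= addKn.
by [].
Qed.

Section Vector.
Variable s : nat.
Implicit Types (f : 'I_s -> nat -> F) (k : 'I_s -> {poly F}).

(* The coefficients of x^{-1}, ..., x^{-m} in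
   k_1 f_1 + ... + k_s f_s vanish. *)
Definition annihilates m f k : bool :=
  [forall j : 'I_m, \sum_i pairing (f i) ('X^j * k i) == 0].

Lemma annihilatesP m f k : reflect
  (forall c : {poly F}, (size c <= m)%N -> \sum_i pairing (f i) (c * k i) = 0)
  (annihilates m f k).
Proof.
apply: (iffP forallP) => [h c cm|h j]; last first.
  by apply/eqP; apply: h; rewrite size_polyXn.
rewrite -[c]coefK poly_def.
under eq_bigr do rewrite mulr_suml linear_sum.
rewrite exchange_big; apply: big1 => /= t _.
have /eqP := h (widen_ord cm t) => /= ht.
under eq_bigr do rewrite -scalerAl linearZ.
by rewrite -mulr_sumr ht mulr0.
Qed.

Lemma annihilates_leq m m' f k : (m <= m')%N ->
  annihilates m' f k -> annihilates m f k.
Proof.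
move=> mm' /annihilatesP h; apply/annihilatesP => c cm.
by apply: h; exact: leq_trans mm'.
Qed.

Lemma annihilates_eq m n f f' k : (forall i t, (t < n)%N -> f i t = f' i t) ->
  (forall i, (size (k i) + m <= n.+1)%N) -> annihilates m f k = annihilates m f' k.
Proof.
move=> ff' kn; apply: eq_forallb => j; congr (_ == 0).
apply: eq_bigr => i _; apply: (pairing_eq (n := n)) => // [t tn|]; first exact: ff'.
have := kn i; have := ltn_ord j => jm kin.
rewrite (leq_trans (size_polyMleq _ _))// size_polyXn; lia.
Qed.

Lemma annihilates_shift M m f k :
  annihilates m (fun i t => f i (M + t)%N) k =
  annihilates m f (fun i => 'X^M * k i).
Proof.
apply: eq_forallb => j; congr (_ == 0); apply: eq_bigr => i _.
by rewrite pairing_shift mulrCA.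
Qed.

End Vector.

(** Extension by 0, so that a finite block of coefficients can stand for a series. *)
Definition pad s L (A : 'M[F]_(s, L)) (i : 'I_s) (t : nat) : F :=
  oapp (A i) 0 (insub t).

Lemma padE s L (A : 'M[F]_(s, L)) i t (tL : (t < L)%N) :
  pad A i t = A i (Ordinal tL).
Proof. by rewrite /pad insubT. Qed.

End Pairing.

(** * Convergents and Hankel forms *)

Lemma card_exists_unique (T I : finType) (P : pred T) (B : T -> pred I) :
  (forall x i j, P x -> B x i -> B x j -> i = j) ->
  #|[pred x | P x && [exists i, B x i]]| = (\sum_i #|[pred x | P x && B x i]|)%N.
Proof.
move=> uB; rewrite -sum1_card.
under [RHS]eq_bigr do rewrite -sum1_card big_mkcond.
rewrite exchange_big big_mkcond; apply: eq_bigr => x _ /=.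
rewrite unfold_in /=; case: ifPn => [/andP[Px /existsP[i Bi]]|nP].
  rewrite (bigD1 i)//= unfold_in /= Px Bi big1 ?addn0// => j ji.
  rewrite unfold_in /= Px; case: ifP => //= Bj.
  by rewrite (uB x j i) ?eqxx in ji.
rewrite big1// => i _; rewrite unfold_in /=; case: ifP => // /andP[Px Bi].
by case/negP: nP; rewrite Px; apply/existsP; exists i.
Qed.

Section MonicPoly.
Variables (F : fieldType) (d : nat).
Implicit Types v : 'rV[F]_d.

Definition mon v : {poly F} := 'X^d + rVpoly v.

Lemma size_mon v : size (mon v) = d.+1.
Proof. by rewrite size_polyDl size_polyXn// ltnS size_poly. Qed.

Lemma mon_monic v : mon v \is monic.
Proof.
by rewrite monicE lead_coefDl ?lead_coefXn// size_polyXn ltnS size_poly.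
Qed.

Lemma mon_surj p : p \is monic -> size p = d.+1 -> exists v, p = mon v.
Proof.
move=> pm sp; exists (poly_rV p); rewrite /mon; apply/polyP => i.
rewrite coefD coefXn coef_rVpoly; case: insubP => [j id ji|].
  by rewrite mxE ltn_eqF// add0r ji.
rewrite -leqNgt addr0 leq_eqVlt => /orP[/eqP <-|di].
  by rewrite eqxx; move: pm; rewrite monicE lead_coefE sp => /eqP.
by rewrite gtn_eqF// nth_default// sp.
Qed.

Lemma mon_inj : injective mon.
Proof. by move=> v w /addrI /(can_inj rVpolyK). Qed.

End MonicPoly.

Section Hankel.
Variable F : finFieldType.
Implicit Types (u : nat -> F) (p c : {poly F}).

Lemma pairing_pad s L (A : 'M[F]_(s, L)) i p : (size p <= L)%N ->
  pairing (pad A i) p = \sum_(t < L) p`_t * A i t.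
Proof.
move=> pL; rewrite (pairing_widen _ pL); apply: eq_bigr => t _.
by rewrite (padE A i (ltn_ord t)); congr (_ * A i _); apply: val_inj.
Qed.

(** Adding [b] to coefficient [n] of [A] shifts the pairing with the monic [p] of degree [n] by [b],
    and leaves [Q] unchanged since [Q] sees only earlier coefficients. *)
Lemma card_pivot L n p (Q : pred 'rV[F]_L) : (n < L)%N ->
  p \is monic -> size p = n.+1 ->
  (forall A B : 'rV_L, (forall t : 'I_L, (t < n)%N -> A 0 t = B 0 t) -> Q A = Q B) ->
  #|[pred A | Q A]| =
  (#|[pred A | Q A && (pairing (pad A ord0) p == 0%R)]| * #|F|)%N.
Proof.
move=> nL pm sp Qn; pose sigma b (A : 'rV[F]_L) := A + b *: delta_mx 0 (Ordinal nL).
apply: (card_equidistributed (V := F) (sigma := sigma)) => [b A|b A|b A B /addIr//].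
  rewrite !pairing_pad ?sp//; under eq_bigr do rewrite !mxE mulrDr.
  rewrite big_split /=; congr (_ + _).
  rewrite (bigD1 (Ordinal nL))//= !eqxx big1 ?addr0 => [|t tn].
    rewrite mulr1; move: pm; rewrite monicE lead_coefE sp /= => /eqP ->.
    by rewrite mul1r.
  by rewrite (negPf tn) ?andbF /= !mulr0.
apply: Qn => t tn; rewrite !mxE eqxx /=.
by rewrite (_ : t == _ = false) ?mulr0 ?addr0//; apply/eqP => tE; rewrite tE ltnn in tn.
Qed.

Definition annihilates1 m u p :=
  annihilates m (fun _ : 'I_1 => u) (fun _ => p).

Lemma annihilates1P m u p : reflect
  (forall c, (size c <= m)%N -> pairing u (c * p) = 0) (annihilates1 m u p).
Proof.
apply: (iffP (annihilatesP _ _ _)) => h c cm; have := h c cm.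
  by rewrite big_ord1.
by rewrite big_ord1.
Qed.

Lemma annihilates1S m u p :
  annihilates1 m.+1 u p = annihilates1 m u p && (pairing u ('X^m * p) == 0).
Proof.
apply/idP/andP => [h|[/forallP h hm]].
  split; first exact: annihilates_leq h.
  by move/forallP: h => /(_ ord_max); rewrite big_ord1.
apply/forallP => j; rewrite big_ord1; case: (ltnP j m) => jm.
  by have := h (Ordinal jm); rewrite big_ord1.
have -> : (j : nat) = m by apply/eqP; rewrite eqn_leq jm -ltnS ltn_ord.
exact: hm.
Qed.

Lemma annihilates1_eq m n u u' p : (forall t, (t < n)%N -> u t = u' t) ->
  (size p + m <= n.+1)%N -> annihilates1 m u p = annihilates1 m u' p.
Proof. by move=> uu' pn; apply: (annihilates_eq (n := n)) => [i t|_]; [exact: uu'|]. Qed.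

(** Invertibility of the Hankel matrix with entries [u (i + j)], [i, j < d], expressed by its
    kernel. Classically, [d] is then the degree of the denominator of a convergent of [u]. *)
Definition nonsingular d u :=
  [forall v : 'rV[F]_d, annihilates1 d u (rVpoly v) ==> (v == 0)].

Lemma nonsingularP d u : reflect
  (forall p, (size p <= d)%N -> annihilates1 d u p -> p = 0) (nonsingular d u).
Proof.
apply: (iffP forallP) => [h p pd pu|h v].
  have := h (poly_rV p); rewrite poly_rV_K// pu /= => /eqP vp.
  by rewrite -(poly_rV_K pd) vp linear0.
apply/implyP => /h; rewrite size_poly => /(_ isT) v0.
by rewrite -[v]rVpolyK v0 linear0.
Qed.

Lemma nonsingular_eq d u u' : (forall t, (t < d + d)%N -> u t = u' t) ->
  nonsingular d u = nonsingular d u'.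
Proof.
move=> uu'; apply: eq_forallb => v; congr (_ ==> _).
apply: (annihilates1_eq uu'); rewrite (leq_trans (n := d + d))//.
by rewrite leq_add2r size_poly.
Qed.

(** The lower coefficients solve a square Hankel system, whose linear map is injective and hence, on
    a finite space, bijective. *)
Lemma nonsingular_mon d u : nonsingular d u ->
  exists v : 'rV_d, annihilates1 d u (mon v).
Proof.
move=> /nonsingularP nu.
pose phi (v : 'rV[F]_d) : 'rV[F]_d := \row_j pairing u ('X^j * rVpoly v).
have phiI : injective phi.
  move=> v w vw; apply/eqP; rewrite -subr_eq0; apply/eqP.
  rewrite -[v - w]rVpolyK (nu (rVpoly (v - w))) ?linear0 ?size_poly//.
  apply/forallP => j; rewrite big_ord1 linearB mulrBr linearB /= subr_eq0.
  by move/rowP: vw => /(_ j); rewrite !mxE => ->.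
have [psi _ psiK] := injF_bij phiI.
exists (psi (- \row_j pairing u ('X^j * 'X^d))).
apply/forallP => j; rewrite big_ord1 /mon mulrDr linearD /=.
have /rowP/(_ j) := psiK (- \row_j pairing u ('X^j * 'X^d)).
by rewrite !mxE => ->; rewrite subrr.
Qed.

Lemma mon_unique d u (v w : 'rV_d) : nonsingular d u ->
  annihilates1 d u (mon v) -> annihilates1 d u (mon w) -> v = w.
Proof.
move=> /nonsingularP nu /annihilates1P hv /annihilates1P hw.
apply/eqP; rewrite -subr_eq0 -[v - w]rVpolyK (nu (rVpoly (v - w))) ?linear0 ?size_poly//.
apply/annihilates1P => c cd.
have -> : rVpoly (v - w) = mon v - mon w by rewrite linearB /mon; ring.
by rewrite mulrBr linearB /= hv// hw// subrr.
Qed.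

(** Condition number [m + i] on [p] pivots on coefficient [m + i + d], which neither [Q] nor the
    earlier conditions involve; each of the [g] extra conditions thus divides the count by
    [#|F|]. *)
Lemma card_annihilates1 L d m g n p (Q : pred 'rV[F]_L) :
  (m + g + d <= L)%N -> (n <= m + d)%N -> p \is monic -> size p = d.+1 ->
  (forall A B : 'rV_L, (forall t : 'I_L, (t < n)%N -> A 0 t = B 0 t) -> Q A = Q B) ->
  #|[pred A | Q A && annihilates1 m (pad A ord0) p]| =
  (#|[pred A | Q A && annihilates1 (m + g) (pad A ord0) p]| * #|F| ^ g)%N.
Proof.
move=> mL nm pm sp Qn; elim: g mL => [|g IH] mL; first by rewrite addn0 muln1.
rewrite IH ?expnS ?mulnA; last by lia.
congr (_ * _)%N.
rewrite (@card_pivot L (m + g + d) ('X^(m + g) * p)); last 4 first.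
- lia.
- by rewrite monicMr ?monicXn.
- by rewrite size_monicM ?monicXn ?monic_neq0// size_polyXn sp; lia.
- move=> A B AB; congr (_ && _).
    by apply: Qn => t tn; apply: AB; lia.
  apply: (@annihilates1_eq _ (m + g + d)) => [t tm|]; last by rewrite sp; lia.
  have tL : (t < L)%N by lia.
  by rewrite !(padE _ _ tL) AB.
congr (_ * _)%N; apply: eq_card => A; rewrite !inE.
by rewrite addnS annihilates1S andbA.
Qed.

(* [d] is the degree of the denominator of a convergent of [u], and the next
   partial quotient has degree greater than [g]. *)
Definition good_approx d g u :=
  nonsingular d u && [exists v : 'rV_d, annihilates1 (d + g) u (mon v)].

Lemma good_approx_eq d g u u' : (forall t, (t < d + d + g)%N -> u t = u' t) ->
  good_approx d g u = good_approx d g u'.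
Proof.
move=> uu'; rewrite /good_approx; congr (_ && _).
  by apply: nonsingular_eq => t td; apply: uu'; lia.
apply: eq_existsb => v; apply: (annihilates1_eq uu').
by rewrite size_mon; lia.
Qed.

(** If the Hankel form is nonsingular, exactly one monic polynomial of degree [d] satisfies the
    first [d] conditions. Splitting the count over this polynomial reduces the claim to the [g]
    further conditions on a fixed one. *)
Lemma card_good_approx L d g (Q : pred 'rV[F]_L) : (d + d + g <= L)%N ->
  (forall A B : 'rV_L, (forall t : 'I_L, (t < d + d)%N -> A 0 t = B 0 t) -> Q A = Q B) ->
  (#|[pred A | Q A && good_approx d g (pad A ord0)]| * #|F| ^ g)%N =
  #|[pred A | Q A && nonsingular d (pad A ord0)]|.
Proof.
move=> dL Qd.
pose Q' A := Q A && nonsingular d (pad A ord0).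
have Q'd (A B : 'rV_L) : (forall t : 'I_L, (t < d + d)%N -> A 0 t = B 0 t) -> Q' A = Q' B.
  move=> AB; rewrite /Q' (Qd _ _ AB); congr (_ && _).
  apply: nonsingular_eq => t td; have tL : (t < L)%N by lia.
  by rewrite !(padE _ _ tL) AB.
have uQ' g' (A : 'rV_L) (v w : 'rV_d) : Q' A -> annihilates1 (d + g') (pad A ord0) (mon v) ->
    annihilates1 (d + g') (pad A ord0) (mon w) -> v = w.
  move=> /andP[_ nA] hv hw; apply: (mon_unique nA).
    by apply: annihilates_leq hv; exact: leq_addr.
  by apply: annihilates_leq hw; exact: leq_addr.
have -> : #|[pred A | Q A && good_approx d g (pad A ord0)]| =
    #|[pred A | Q' A && [exists v : 'rV_d, annihilates1 (d + g) (pad A ord0) (mon v)]]|.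
  by apply: eq_card => A; rewrite !inE /Q' /good_approx andbA.
have -> : #|[pred A | Q A && nonsingular d (pad A ord0)]| =
    #|[pred A | Q' A && [exists v : 'rV_d, annihilates1 (d + 0) (pad A ord0) (mon v)]]|.
  apply: eq_card => A; rewrite !inE /Q' -andbA; congr (_ && _).
  case nA: nonsingular => //=; apply/esym/existsP.
  by rewrite addn0; exact: nonsingular_mon.
rewrite !card_exists_unique; last 2 first.
- exact: uQ'.
- exact: uQ'.
rewrite big_distrl; apply: eq_bigr => v _ /=.
rewrite -(@card_annihilates1 L d d g (d + d)) ?mon_monic ?size_mon// ?addn0//.
by lia.
Qed.

(** The monic polynomial of degree [d] lies in the kernel of every Hankel form of order from [d + 1]
    to [d + g]. *)
Lemma good_approx_disjoint d d' g u : (d < d' <= d + g)%N ->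
  good_approx d g u -> nonsingular d' u -> False.
Proof.
move=> /andP[dd' d'g] /andP[_ /existsP[v hv]] /nonsingularP /(_ (mon v)).
rewrite size_mon dd' => /(_ isT (annihilates_leq d'g hv)) => mv0.
by have := monic_neq0 (mon_monic v); rewrite mv0 eqxx.
Qed.

(** Take the largest [j < d] of nonsingular order. Its monic solution satisfies all conditions up to
    [d], because a first failure at [t] would make order [t + 1] nonsingular, against the choice of
    [j] or the singularity at [d]. *)
Lemma singular_good_approx d u : ~~ nonsingular d u ->
  exists2 j : nat, (j < d)%N & good_approx j (d - j) u.
Proof.
move=> sd.
have ex0 : exists j, (j < d)%N && nonsingular j u.
  exists 0%N; apply/andP; split.
    case: d sd => // /negP []; apply/nonsingularP => p.
    by rewrite leqn0 size_poly_eq0 => /eqP.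
  by apply/nonsingularP => p; rewrite leqn0 size_poly_eq0 => /eqP.
have exb j : (j < d)%N && nonsingular j u -> (j <= d)%N by case/andP => /ltnW.
have [j /andP[jd nj] jmax] := ex_maxnP ex0 exb.
exists j => //; rewrite /good_approx nj /=; apply/existsP.
have [v hv] := nonsingular_mon nj; exists v; rewrite (subnKC (ltnW jd)).
set k := mon v in hv *.
have km : k \is monic by exact: mon_monic.
have ind t : (j <= t <= d)%N -> annihilates1 t u k.
  elim: t => [|t IH].
    by rewrite leqn0 => /andP[/eqP <- _].
  rewrite leq_eqVlt => /andP[/orP[/eqP <-//|jt] td].
  have ht : annihilates1 t u k by apply: IH; rewrite -ltnS jt ltnW.
  rewrite annihilates1S ht /=; apply/negPn/negP => nz.
  suff nt : nonsingular t.+1 u.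
    have [td'|dt] := ltnP t.+1 d.
      by have := jmax t.+1; rewrite td' nt => /(_ isT); lia.
    have td' : t.+1 = d by lia.
    by rewrite -td' nt in sd.
  apply/nonsingularP => r rt hr.
  (* A kernel element [r] of order [t + 1] is divided by [k]; the remainder lies in the kernel of
     order [j] and so vanishes. *)
  have [p [r0 [rE r0j pt]]] : exists p r0 : {poly F},
      [/\ r = p * k + r0, (size r0 <= j)%N & (size p <= t.+1 - j)%N].
    exists (r %/ k)%R, (r %% k)%R; split; first exact: divp_eq.
      by rewrite -ltnS -(size_mon v) ltn_modp monic_neq0.
    by rewrite size_divp ?monic_neq0// size_mon /= leq_sub2r.
  have r00 : r0 = 0.
    apply: (nonsingularP _ _ nj) => //; apply/annihilates1P => c cj.
    have := annihilates1P _ _ _ hr c (leq_trans cj (ltnW jt)).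
    rewrite rE mulrDr linearD /= mulrA (annihilates1P _ _ _ ht) ?add0r//.
    by rewrite (leq_trans (size_polyMleq _ _))//; lia.
  have [p0|p0] := eqVneq p 0; first by rewrite rE p0 mul0r r00 addr0.
  pose e := (size p).-1.
  have sp : size p = e.+1 by rewrite /e prednK// size_poly_gt0.
  (* The multiplier ['X^(t - e) * p] has degree [t]. Its part [p'] of lower degree contributes
     nothing, and its top term leaves [lead_coef p] times the nonzero pairing with ['X^t * k], which
     forces [p = 0]. *)
  have := annihilates1P _ _ _ hr 'X^(t - e).
  rewrite size_polyXn rE r00 addr0 mulrA => hXp; have {}hXp := hXp ltac:(lia); move: hXp.
  pose p' := 'X^(t - e) * p - lead_coef p *: 'X^t.
  have -> : 'X^(t - e) * p = p' + lead_coef p *: 'X^t by rewrite subrK.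
  rewrite mulrDl linearD /= (annihilates1P _ _ _ ht) ?add0r.
    rewrite -scalerAl linearZ /= => /eqP; rewrite mulf_eq0 (negPf nz) orbF.
    by rewrite lead_coef_eq0 (negPf p0).
  apply/leq_sizeP => i ti; rewrite /p' coefB coefXnM coefZ coefXn.
  case: ltnP => [it|_]; first by lia.
  move: ti; rewrite leq_eqVlt => /orP[/eqP <-|ti].
    rewrite eqxx mulr1 lead_coefE sp /=; have -> : (t - (t - e) = e)%N by lia.
    by rewrite subrr.
  by rewrite gtn_eqF// mulr0 subr0 nth_default// sp; lia.
by apply: ind; rewrite (ltnW jd) leqnn.
Qed.

(* The last convergent of degree [j < d] of a singular [u] has a gap [d - j];
   this costs a factor [#|F|] with respect to a gap [d - 1 - j], and the latter
   events are disjoint for distinct [j]. *)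
Lemma card_nonsingular L d : (d + d <= L)%N ->
  (#|[pred A : 'rV[F]_L | ~~ nonsingular d (pad A ord0)]| * #|F| <= #|{: 'rV[F]_L}|)%N.
Proof.
case: d => [_|d dL].
  rewrite (_ : #|_| = 0%N)//; apply: eq_card0 => A; rewrite !inE.
  apply/negbTE; rewrite negbK; apply/nonsingularP => p.
  by rewrite leqn0 size_poly_eq0 => /eqP.
apply: (@leq_trans (\sum_(j < d.+1) #|[pred A : 'rV[F]_L | true && good_approx j (d.+1 - j) (pad A ord0)]| * #|F|)%N).
  rewrite -big_distrl leq_mul2r; apply/orP; right.
  rewrite -sum1_card; under [leqRHS]eq_bigr do rewrite -sum1_card big_mkcond.
  rewrite exchange_big big_mkcond /=; apply: leq_sum => A _.
  rewrite unfold_in /=; case: ifP => // /singular_good_approx[j jd gj].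
  by rewrite (bigD1 (Ordinal jd))//= unfold_in /= gj.
apply: (@leq_trans (\sum_(j < d.+1) #|[pred A : 'rV[F]_L | true && good_approx j (d - j) (pad A ord0)]|)%N).
  apply: leq_sum => j _.
  have F0 : (0 < #|F| ^ (d - j))%N by rewrite expn_gt0 (cardD1 0) inE.
  have jd : (j <= d)%N by rewrite -ltnS.
  rewrite -(leq_pmul2r F0) -mulnA -expnS -subSn//.
  by rewrite !card_good_approx//; have := ltn_ord j; lia.
have -> : (\sum_(j < d.+1) #|[pred A : 'rV[F]_L | true && good_approx j (d - j) (pad A ord0)]|)%N =
    #|[pred A : 'rV[F]_L | true && [exists j : 'I_d.+1, good_approx j (d - j) (pad A ord0)]]|.
  rewrite card_exists_unique// => A i j _ hi hj; apply/val_inj/eqP.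
  case: (ltngtP i j) => // ij.
    by case: (good_approx_disjoint _ hi (andP hj).1); have := ltn_ord j; lia.
  by case: (good_approx_disjoint _ hj (andP hi).1); have := ltn_ord i; lia.
exact: max_card.
Qed.

End Hankel.

(** * Independence of coprime vectors *)

Section LinearConditions.
Variables (F : finFieldType) (s L : nat).

(** Linearly independent conditions form a matrix of full row rank, so every vector of values is
    attained equally often. *)
Lemma card_pairing_eq0 (I : finType) (V : I -> 'I_s -> {poly F}) :
  (forall a i, (size (V a i) <= L)%N) ->
  (forall c : I -> F, (forall i, \sum_a c a *: V a i = 0) -> forall a, c a = 0) ->
  #|{: 'M[F]_(s, L)}| =
  (#|[pred A : 'M[F]_(s, L) |
      [forall a, (\sum_i pairing (pad A i) (V a i))%R == 0%R]]| * #|F| ^ #|I|)%N.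
Proof.
move=> VL Vfree.
pose M := \matrix_(a < #|I|) mxvec (\matrix_(i < s, t < L) (V (enum_val a) i)`_t).
have Mfree : row_free M.
  apply: inj_row_free => v vM; apply/rowP => a; rewrite mxE.
  rewrite -[a]enum_valK; apply: (Vfree (fun b => v 0 (enum_rank b))) => i; apply/polyP => t; rewrite coef0 coef_sum.
  have [tL|Lt] := ltnP t L; last first.
    by apply: big1 => b _; rewrite coefZ nth_default ?mulr0// (leq_trans (VL b i)).
  move/rowP: vM => /(_ (mxvec_index i (Ordinal tL))); rewrite !mxE => vM.
  rewrite -[RHS]vM (reindex _ (onW_bij _ (enum_val_bij I)))/=.
  by apply: eq_bigr => b _; rewrite coefZ enum_valK !mxE mxvecE mxE.
have [N MN] := row_freeP Mfree.
pose h (A : 'M[F]_(s, L)) := mxvec A *m M^T.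
have hE A a : h A 0 (enum_rank a) = \sum_i pairing (pad A i) (V a i).
  rewrite !mxE (reindex _ (curry_mxvec_bij _ _))/=.
  transitivity (\sum_i \sum_t mxvec A 0 (mxvec_index i t) * M^T (mxvec_index i t) (enum_rank a)).
    by rewrite pair_bigA; apply: eq_bigr => -[].
  apply: eq_bigr => i _; rewrite pairing_pad//; apply: eq_bigr => t _.
  by rewrite mxvecE !mxE mxvecE mxE enum_rankK mulrC.
(* The right inverse [N] yields a translation of [A] that shifts the values [h A] by exactly [b]. *)
pose sigma (b : 'rV[F]_#|I|) A := A + vec_mx (b *m N^T).
transitivity #|[pred A : 'M[F]_(s, L) | true]|; first by apply: eq_card.
rewrite (card_equidistributed (h := h) (sigma := sigma)) => [|b A|//|b A B /addIr//].
  rewrite card_mx mul1n; congr (_ * _)%N; apply: eq_card => A; rewrite !inE /=.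
  apply/eqP/forallP => [hA a|hA].
    by rewrite -hE hA mxE.
  by apply/rowP => a; rewrite [RHS]mxE -[a]enum_valK hE; apply/eqP.
by rewrite /h /sigma linearD /= vec_mxK mulmxDl -mulmxA -trmx_mul MN trmx1 mulmx1.
Qed.

Lemma coef_sum_polyXn n (c : 'I_n -> F) (j : 'I_n) : (\sum_a c a *: 'X^a)`_j = c j.
Proof.
rewrite coef_sum (bigD1 j)//= coefZ coefXn eqxx mulr1 big1 ?addr0// => a aj.
by rewrite coefZ coefXn (inj_eq val_inj) eq_sym (negPf aj) mulr0.
Qed.

Lemma card_annihilates m (k : 'I_s -> {poly F}) :
  (exists i, k i != 0) -> (forall i, (size (k i) + m <= L.+1)%N) ->
  #|{: 'M[F]_(s, L)}| =
  (#|[pred A : 'M[F]_(s, L) | annihilates m (pad A) k]| * #|F| ^ m)%N.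
Proof.
move=> [i0 k0] kL.
rewrite (card_pairing_eq0 (V := fun (j : 'I_m) i => 'X^j * k i)).
- by rewrite card_ord.
- move=> j i; rewrite (leq_trans (size_polyMleq _ _))// size_polyXn.
  by have := kL i; have := ltn_ord j; lia.
move=> c /(_ i0); under eq_bigr do rewrite scalerAl.
rewrite -mulr_suml => /eqP; rewrite mulf_eq0 (negPf k0) orbF => /eqP c0 j.
by rewrite -(coef_sum_polyXn c) c0 coef0.
Qed.

(** Independence of [k] and [k'] over the polynomial ring makes the [m + m'] conditions independent
    over [F]. *)
Lemma card_annihilates2 m m' (k k' : 'I_s -> {poly F}) :
  (forall c c' : {poly F}, (forall i, c * k i + c' * k' i = 0) -> c = 0 /\ c' = 0) ->
  (forall i, (size (k i) + m <= L.+1)%N) ->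
  (forall i, (size (k' i) + m' <= L.+1)%N) ->
  #|{: 'M[F]_(s, L)}| =
  (#|[pred A : 'M[F]_(s, L) | annihilates m (pad A) k && annihilates m' (pad A) k']|
    * #|F| ^ (m + m'))%N.
Proof.
move=> kk' kL k'L.
pose V (a : 'I_m + 'I_m') i :=
  match a with inl j => 'X^j * k i | inr j => 'X^j * k' i end.
rewrite (card_pairing_eq0 (V := V)).
- rewrite card_sum !card_ord; congr (_ * _)%N; apply: eq_card => A; rewrite !inE.
  apply/forallP/andP => [h|[/forallP h /forallP h'] [j|j]].
  + by split; apply/forallP => j; [exact: (h (inl j))|exact: (h (inr j))].
  + exact: h.
  + exact: h'.
- move=> [j|j] i; rewrite (leq_trans (size_polyMleq _ _))// size_polyXn.
    by have := kL i; have := ltn_ord j; lia.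
  by have := k'L i; have := ltn_ord j; lia.
move=> c c0.
have [i|c1 c2] := kk' (\sum_(j < m) c (inl j) *: 'X^j) (\sum_(j < m') c (inr j) *: 'X^j).
  rewrite !mulr_suml -[RHS](c0 i) big_sumType /=.
  by congr (_ + _); apply: eq_bigr => j _; rewrite scalerAl.
case=> j; first by have := coef_sum_polyXn (c \o inl) j; rewrite /= c1 coef0.
by have := coef_sum_polyXn (c \o inr) j; rewrite /= c2 coef0.
Qed.

End LinearConditions.

Section Coprime.
Variable F : fieldType.
Implicit Types a b : {poly F}.

Definition mgcd a b := (lead_coef (gcdp a b))^-1 *: gcdp a b.

Lemma mgcd_monic a b : a != 0 -> mgcd a b \is monic.
Proof.
move=> a0; rewrite monicE lead_coefZ mulVf// lead_coef_eq0 gcdp_eq0.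
by rewrite (negPf a0).
Qed.

Lemma mgcd_eqp a b : a != 0 -> mgcd a b %= gcdp a b.
Proof.
move=> a0; apply: eqp_scale; rewrite invr_eq0 lead_coef_eq0 gcdp_eq0.
by rewrite (negPf a0).
Qed.

(* A monic non-coprime pair [(g a, g b)] is encoded by the constant term [c] of
   [g = g' * 'X + c] and the pair [(g' a, g' b)], whose gcd is [g']; so at most
   one pair out of [#|F|] is non-coprime. *)
Definition shrink a b :=
  ((mgcd a b)`_0, (mgcd a b %/ 'X * (a %/ mgcd a b), mgcd a b %/ 'X * (b %/ mgcd a b))).

Lemma shrinkP a b : a \is monic -> b \is monic -> ~~ coprimep a b ->
  exists g c a' b', [/\ [/\ g \is monic, coprimep a' b', a' \is monic & b' \is monic],
    a = (g * 'X + c%:P) * a', b = (g * 'X + c%:P) * b' &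
    shrink a b = (c, (g * a', g * b'))].
Proof.
move=> am bm ab; set g := mgcd a b.
have a0 := monic_neq0 am.
have gm : g \is monic by exact: mgcd_monic.
have gE : g %= gcdp a b by exact: mgcd_eqp.
have ga : a = g * (a %/ g) by rewrite mulrC divpK// (eqp_dvdl _ gE) dvdp_gcdl.
have gb : b = g * (b %/ g) by rewrite mulrC divpK// (eqp_dvdl _ gE) dvdp_gcdr.
have sg : (1 < size g)%N.
  rewrite (eqp_size gE) ltn_neqAle eq_sym -[_ == 1%N]/(coprimep a b) ab.
  by rewrite size_poly_gt0 gcdp_eq0 (negPf a0).
have gX : g = g %/ 'X * 'X + (g`_0)%:P.
  rewrite {1}(divp_eq g 'X); congr (_ + _).
  by have := modp_XsubC g 0; rewrite subr0 horner_coef0.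
exists (g %/ 'X), g`_0, (a %/ g), (b %/ g); split; first split.
- have gX0 : g %/ 'X != 0.
    by apply: contraTneq sg => g0; rewrite gX g0 mul0r add0r size_polyC -leqNgt leq_b1.
  rewrite monicE -lead_coefMX -(@lead_coefDl _ _ (g`_0)%:P) -?gX -?monicE//.
  by rewrite size_mulX// size_polyC (leq_ltn_trans (leq_b1 _))// ltnS size_poly_gt0.
- rewrite -gcdp_eqp1 -(eqp_mul2l _ _ (monic_neq0 gm)) mulr1.
  by rewrite (eqp_ltrans (mulp_gcdr _ _ _)) -ga -gb eqp_sym.
- by move: am; rewrite {1}ga monicMl.
- by move: bm; rewrite {1}gb monicMl.
- by rewrite -gX.
- by rewrite -gX.
- by [].
Qed.

(** The monic gcd of the shrunken pair recovers [g], hence the coprime cofactors; together with the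
    constant term this determines the original pair. *)
Lemma shrink_inj a b c d : a \is monic -> b \is monic -> c \is monic -> d \is monic ->
  ~~ coprimep a b -> ~~ coprimep c d -> shrink a b = shrink c d -> (a, b) = (c, d).
Proof.
move=> am bm cm dm ab cd.
have [g [e [a' [b' [[gm ab' a'm b'm] -> -> ->]]]]] := shrinkP am bm ab.
have [h [f [c' [d' [[hm cd' c'm d'm] -> -> ->]]]]] := shrinkP cm dm cd.
case=> <- gh1 gh2.
have gcdE (x y z : {poly F}) : coprimep y z -> gcdp (x * y) (x * z) %= x.
  move=> yz; rewrite (eqp_trans (gcdp_mul2l _ _ _))// -[X in _ %= X]mulr1.
  by rewrite (eqp_mull _ _)// gcdp_eqp1.
have gh : g = h.
  apply/eqP; rewrite -eqp_monic// -(eqp_ltrans (gcdE g _ _ ab')) gh1 gh2.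
  exact: gcdE.
rewrite gh in gh1 gh2 *.
have h0 := monic_neq0 hm.
by rewrite (mulfI h0 gh1) (mulfI h0 gh2).
Qed.

Lemma shrink_size a b : a \is monic -> b \is monic -> ~~ coprimep a b ->
  [/\ (shrink a b).2.1 \is monic, (shrink a b).2.2 \is monic,
    size a = (size (shrink a b).2.1).+1 & size b = (size (shrink a b).2.2).+1].
Proof.
move=> am bm ab.
have [g [c [a' [b' [[gm ab' a'm b'm] -> -> ->]]]]] := shrinkP am bm ab.
have g0 := monic_neq0 gm.
have sg : (0 < size g)%N by rewrite size_poly_gt0.
have sX : size (g * 'X + c%:P) = (size g).+1.
  by rewrite size_polyDl size_mulX// size_polyC (leq_ltn_trans (leq_b1 _)).
have X0 : g * 'X + c%:P != 0 by rewrite -size_poly_gt0 sX.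
split; rewrite /= ?monicMl//.
  rewrite (size_mul X0 (monic_neq0 a'm)) (size_mul g0 (monic_neq0 a'm)) sX.
  by case: (size g) sg => // n _; rewrite !addSn.
rewrite (size_mul X0 (monic_neq0 b'm)) (size_mul g0 (monic_neq0 b'm)) sX.
by case: (size g) sg => // n _; rewrite !addSn.
Qed.

(** If two such vectors are proportional, cross-multiplying their first two entries and applying the
    Gauss lemma shows that the first entries divide each other. Being monic they agree, the factor
    of proportionality is 1, and the vectors coincide. *)
Lemma coprime_free n (k k' : 'I_n.+2 -> {poly F}) :
  (forall i, k i \is monic) -> (forall i, k' i \is monic) ->
  coprimep (k ord0) (k (lift ord0 ord0)) -> coprimep (k' ord0) (k' (lift ord0 ord0)) ->
  (exists i, k i != k' i) ->
  forall c c' : {poly F}, (forall i, c * k i + c' * k' i = 0) -> c = 0 /\ c' = 0.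
Proof.
move=> km k'm kc k'c [i ki] c c' h.
have [c0|c0] := eqVneq c 0.
  split=> //; have := h i; rewrite c0 mul0r add0r => /eqP.
  by rewrite mulf_eq0 (negPf (monic_neq0 (k'm i))) orbF => /eqP.
have hN j : c * k j = - c' * k' j by rewrite mulNr; apply/eqP; rewrite -addr_eq0 h.
have cross : k ord0 * k' (lift ord0 ord0) = k (lift ord0 ord0) * k' ord0.
  apply: (mulfI c0); rewrite !mulrA !hN; ring.
have k0 : k ord0 = k' ord0.
  apply/eqP; rewrite -eqp_monic// /eqp.
  rewrite -(Gauss_dvdpr _ kc) -cross dvdp_mulr//=.
  by rewrite -(Gauss_dvdpl _ k'c) cross dvdp_mull.
have cc' : c = - c'.
  by apply: (mulIf (monic_neq0 (km ord0))); rewrite hN k0.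
case/eqP: ki; apply: (mulfI c0); rewrite hN cc' //.
Qed.

End Coprime.

(** * Khinchin-type lower bound *)

Lemma card_dyadic n j : (2 ^ j.+1 <= n)%N ->
  #|[pred d : 'I_n | (2 ^ j <= d < 2 ^ j.+1)%N]| = (2 ^ j)%N.
Proof.
move=> jn; rewrite -sum1_card.
under eq_bigl do rewrite unfold_in /= andbC.
rewrite -(big_geq_mkord (2 ^ j) n (fun d => (d < 2 ^ j.+1)%N) (fun=> 1%N)).
rewrite -(big_nat_widen _ _ _ xpredT (fun=> 1%N) jn) sum_nat_const_nat expnS.
by lia.
Qed.

Lemma dyadic_inj i j d : (2 ^ i <= d < 2 ^ i.+1)%N -> (2 ^ j <= d < 2 ^ j.+1)%N -> i = j.
Proof.
move=> /andP[id di] /andP[jd dj].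
have ij : (i < j.+1)%N by rewrite -(ltn_exp2l i j.+1 (isT : 1 < 2)%N) (leq_ltn_trans id).
have ji : (j < i.+1)%N by rewrite -(ltn_exp2l j i.+1 (isT : 1 < 2)%N) (leq_ltn_trans jd).
by apply/eqP; rewrite eqn_leq -ltnS ij -ltnS ji.
Qed.

Section MonicVectors.
Variables (F : finFieldType) (B : nat).

Lemma card_monic d : (d < B)%N ->
  #|[pred w : 'rV[F]_B | (rVpoly w \is monic) && (size (rVpoly w) == d.+1)]| = (#|F| ^ d)%N.
Proof.
move=> dB; pose m (v : 'rV[F]_d) : 'rV[F]_B := poly_rV (mon v).
have mK v : rVpoly (m v) = mon v by rewrite poly_rV_K ?size_mon.
have mI : injective m by move=> v w vw; apply: mon_inj; rewrite -!mK vw.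
rewrite -[in RHS](mul1n d) -card_mx -(card_codom mI); apply: eq_card => w.
rewrite !inE; apply/andP/codomP => [[wm /eqP ws]|[v ->]].
  have [v vE] := mon_surj wm ws; exists v.
  by apply: (can_inj (@rVpolyK F B)); rewrite mK.
by rewrite mK mon_monic size_mon.
Qed.

Definition monic_vector s (d : 'I_s -> nat) (v : {ffun 'I_s -> 'rV[F]_B}) :=
  [forall i, (rVpoly (v i) \is monic) && (size (rVpoly (v i)) == (d i).+1)].

Lemma card_monic_vector s (d : 'I_s -> nat) : (forall i, (d i < B)%N) ->
  #|[pred v | monic_vector d v]| = (#|F| ^ \sum_i d i)%N.
Proof.
move=> dB.
transitivity #|family (fun i => [pred w : 'rV[F]_B |
    (rVpoly w \is monic) && (size (rVpoly w) == (d i).+1)])|.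
  by apply: eq_card => v; rewrite !inE; apply: eq_forallb => i.
rewrite card_family foldrE big_image /= expn_sum.
by apply: eq_bigr => i _; rewrite card_monic.
Qed.

Variable s : nat.
Local Notation i1 := (lift ord0 ord0 : 'I_s.+2).

Definition coprime_head (v : {ffun 'I_s.+2 -> 'rV[F]_B}) :=
  coprimep (rVpoly (v ord0)) (rVpoly (v i1)).

(** [shrink] embeds the non-coprime vectors into [F] times the monic vectors whose first two degrees
    are lowered by one, a set of size [#|F|] to the power [\sum_i d i - 1]. *)
Lemma card_noncoprime (d : 'I_s.+2 -> nat) : (forall i, 0 < d i < B)%N ->
  (#|[pred v | monic_vector d v && ~~ coprime_head v]| * #|F| <= #|F| ^ \sum_i d i)%N.
Proof.
move=> dB.
pose d' i := (if (i == ord0) || (i == i1) then (d i).-1 else d i)%N.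
have dB' i : (d' i < B)%N.
  by rewrite /d'; have := dB i; case: ifP => _; lia.
have sd : (\sum_i d i = (\sum_i d' i).+2)%N.
  rewrite !big_ord_recl.
  have -> : (\sum_(i < s) d' (lift ord0 (lift ord0 i)) =
      \sum_(i < s) d (lift ord0 (lift ord0 i)))%N.
    by apply: eq_bigr => i _; rewrite /d' (inj_eq lift_inj).
  rewrite /d' !eqxx orbT; have := dB ord0; have := dB i1.
  by move: (d ord0) (d i1) (\sum_(i < s) _)%N => x y z /=; lia.
pose phi (v : {ffun 'I_s.+2 -> 'rV[F]_B}) : F * {ffun 'I_s.+2 -> 'rV[F]_B} :=
  let t := shrink (rVpoly (v ord0)) (rVpoly (v i1)) in
  (t.1, [ffun i => if i == ord0 then poly_rV t.2.1
                   else if i == i1 then poly_rV t.2.2 else v i]).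
have sB (v : {ffun 'I_s.+2 -> 'rV[F]_B}) i : (size (rVpoly (v i)) <= B)%N by exact: size_poly.
have N_phi v : monic_vector d v && ~~ coprime_head v -> monic_vector d' (phi v).2.
  case/andP => /forallP hv nc; apply/forallP => i.
  have [[m0 /eqP s0] [m1 /eqP s1]] := (andP (hv ord0), andP (hv i1)).
  have [t1m t2m e1 e2] := shrink_size m0 m1 nc.
  rewrite ffunE /d'; case: eqVneq => [->|i0] /=.
    rewrite poly_rV_K ?t1m /=; last by rewrite -ltnS -e1 leqW.
    by move: e1; rewrite s0 => -[<-]; rewrite prednK//; case/andP: (dB ord0).
  case: eqVneq => [->|ii1] /=; last exact: hv.
  rewrite poly_rV_K ?t2m /=; last by rewrite -ltnS -e2 leqW.
  by move: e2; rewrite s1 => -[<-]; rewrite prednK//; case/andP: (dB i1).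
have phi_inj : {in [pred v | monic_vector d v && ~~ coprime_head v] &, injective phi}.
  move=> v w; rewrite !inE => /andP[/forallP hv ncv] /andP[/forallP hw ncw] vw.
  have [[m0 _] [m1 _]] := (andP (hv ord0), andP (hv i1)).
  have [[n0 _] [n1 _]] := (andP (hw ord0), andP (hw i1)).
  have [_ _ a1 a2] := shrink_size m0 m1 ncv.
  have [_ _ b1 b2] := shrink_size n0 n1 ncw.
  have t1 : (shrink (rVpoly (v ord0)) (rVpoly (v i1))).1 =
    (shrink (rVpoly (w ord0)) (rVpoly (w i1))).1 := congr1 fst vw.
  have /ffunP t2 := congr1 snd vw.
  have := t2 ord0; rewrite !ffunE eqxx => c1; have := t2 i1; rewrite !ffunE eqxx => c2.
  have t12 : shrink (rVpoly (v ord0)) (rVpoly (v i1)) =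
      shrink (rVpoly (w ord0)) (rVpoly (w i1)).
    move: t1 c1 c2 a1 a2 b1 b2; case: (shrink _ _) => x [y z].
    case: (shrink _ _) => x' [y' z'] /= -> c1 c2 a1 a2 b1 b2.
    rewrite -(@poly_rV_K _ B y) ?c1 ?poly_rV_K//; last 2 first.
    - by rewrite -ltnS -b1 leqW.
    - by rewrite -ltnS -a1 leqW.
    rewrite -(@poly_rV_K _ B z) ?c2 ?poly_rV_K//.
      by rewrite -ltnS -b2 leqW.
    by rewrite -ltnS -a2 leqW.
  case: (shrink_inj m0 m1 n0 n1 ncv ncw t12) => /(can_inj (@rVpolyK F B)) v0 /(can_inj (@rVpolyK F B)) v1.
  apply/ffunP => i; have := t2 i; rewrite !ffunE.
  by case: eqVneq => [->|_] //; case: eqVneq => [->|_].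
rewrite -(fintype.card_in_image phi_inj) sd.
apply: (@leq_trans (#|[predX predT & [pred v | monic_vector d' v]] : {pred F * _}| * #|F|)%N).
  rewrite leq_mul2r; apply/orP; right; apply: fintype.subset_leq_card.
  by apply/fintype.subsetP => x /fintype.imageP[v hv ->]; rewrite !inE /=; exact: N_phi.
by rewrite cardX card_monic_vector// !expnS mulnC.
Qed.

End MonicVectors.

Section Hits.
Variables (F : finFieldType) (R : realFieldType).
Local Notation q := (#|F|%:R : R).

(* All degrees lie in one dyadic range [2 ^ j, 2 ^ j.+1[, so that the excess
   [gam] may depend on [j] only. *)
Definition dyadic_hit s J J' (gam : nat -> nat) (f : 'I_s -> nat -> F) : Prop :=
  exists j (k : 'I_s -> {poly F}), [/\ (J <= j < J')%N, forall i, k i \is monic,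
    forall i, (2 ^ j < size (k i) <= 2 ^ j.+1)%N &
    annihilates (\sum_i (size (k i)).-1 + gam j) f k].

Lemma card_field_gt1 : (1 < #|F|)%N.
Proof. by rewrite (cardD1 0) (cardD1 1) !inE oner_eq0. Qed.

Let q_gt0 : 0 < q.
Proof. by rewrite ltr0n (ltn_trans _ card_field_gt1). Qed.

Lemma leq_dyadic_gam J' (gam : nat -> nat) j : (j < J')%N -> (gam j <= \sum_(i < J') gam i)%N.
Proof. by move=> jJ; rewrite (bigD1 (Ordinal jJ))//= leq_addr. Qed.

Lemma dyadic_lt J' j : (j < J')%N -> (2 ^ j.+1 <= 2 ^ J')%N.
Proof. by move=> jJ; rewrite leq_exp2l. Qed.

(** If [d' <= d + g] the two events exclude each other. Otherwise the first one depends only on the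
    coefficients of index below [2 d + g < 2 d'], so the gap after [d'] is independent of it. *)
Lemma card_good_approx_pair L d d' g g' : (d < d')%N ->
  (d + d + g <= L)%N -> (d' + d' + g' <= L)%N ->
  #|[pred A : 'rV[F]_L | good_approx d g (pad A ord0) && good_approx d' g' (pad A ord0)]|%:R
  <= q ^- g * q ^- g' * #|{: 'rV[F]_L}|%:R.
Proof.
move=> dd' dL dL'.
have [d'g|dg] := leqP d' (d + g).
  rewrite eq_card0; first by rewrite !mulr_ge0// invr_ge0 exprn_ge0 ?ler0n.
  move=> A; rewrite !inE; apply/negbTE/negP => /andP[h /andP[h' _]].
  by apply: (good_approx_disjoint _ h h'); rewrite dd'.
have h1 := @card_good_approx F L d g predT dL (fun _ _ _ => erefl).
have h2 := @card_good_approx F L d' g' (fun A => good_approx d g (pad A ord0)) dL'.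
rewrite -mulrA ler_pdivlMl ?exprn_gt0// ler_pdivlMl ?exprn_gt0// -!natrX -!natrM ler_nat.
rewrite mulnCA [(_ ^ g' * _)%N]mulnC h2 => [|A A' AA']; last first.
  apply: good_approx_eq => t td; have tL : (t < L)%N by lia.
  by rewrite !(padE _ _ tL) AA'//=; lia.
apply: (@leq_trans (#|F| ^ g * #|[pred A : 'rV[F]_L | true && good_approx d g (pad A ord0)]|)%N).
  rewrite leq_mul2l; apply/orP; right; apply: fintype.subset_leq_card; apply/fintype.subsetP => A.
  by rewrite !inE => /andP[].
by rewrite mulnC h1; exact: max_card.
Qed.

Lemma hits_1 J J' (gam : nat -> nat) L : (2 * 2 ^ J' + \sum_(j < J') gam j <= L)%N ->
  1 <= \sum_(j < J' | (J <= j)%N) (2 ^ j)%:R / q ^+ gam j ->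
  exists2 Q : pred 'M[F]_(1, L), forall A, Q A -> dyadic_hit J J' gam (pad A) &
    8%:R^-1 * #|{: 'M[F]_(1, L)}|%:R <= #|[pred A | Q A]|%:R :> R.
Proof.
move=> JL S1; set n := (2 ^ J')%N.
pose P (x : 'I_J' * 'I_n) := ((J <= x.1)%N && (2 ^ x.1 <= x.2 < 2 ^ x.1.+1)%N).
pose E (x : 'I_J' * 'I_n) (A : 'M[F]_(1, L)) := good_approx x.2 (gam x.1) (pad A ord0).
exists (fun A => [exists x, P x && E x A]) => [A /existsP[[j d]]|].
  rewrite /P /E /= => /andP[/andP[Jj jd] /andP[_ /existsP[v hv]]].
  exists j, (fun=> mon v); split => [|i|i|]; rewrite ?mon_monic ?Jj ?ltn_ord//.
    by rewrite size_mon ltnS.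
  rewrite big_ord1 size_mon /=; apply/annihilatesP => c cd.
  by rewrite big_ord1; exact: (annihilates1P _ _ _ hv).
have xL (x : 'I_J' * 'I_n) : (x.2 + x.2 + gam x.1 <= L)%N.
  have := leq_dyadic_gam gam (ltn_ord x.1); have := ltn_ord x.2; rewrite -/n in JL *; lia.
(* Here [c = 1/2]: at most one Hankel form in [#|F| >= 2] is singular. This gives the proportion
   [c ^ 2 / 2 = 1/8]. *)
have := @second_moment R 'M[F]_(1, L) _ P E (fun x => q ^- gam x.1) 2%:R^-1.
rewrite (_ : 2%:R^-1 ^+ 2 / 2%:R = 8%:R^-1); last by rewrite expr2; field.
apply.
- by rewrite invr_gt0 ltr0n.
- by move=> x _; rewrite invr_ge0 exprn_ge0 ?ler0n.
- rewrite (le_trans S1)// /P.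
  rewrite -(pair_big_dep (fun j : 'I_J' => (J <= j)%N)
     (fun (j : 'I_J') (d : 'I_n) => (2 ^ j <= d < 2 ^ j.+1)%N) (fun j d => q ^- gam j)) /=.
  apply: ler_sum => j _; rewrite sumr_const card_dyadic ?dyadic_lt//.
  by rewrite mulr_natl.
- move=> x Px; have := @card_good_approx F L x.2 (gam x.1) predT (xL x) (fun _ _ _ => erefl).
  have xL2 : (x.2 + x.2 <= L)%N by rewrite (leq_trans _ (xL x))// leq_addr.
  have -> : #|[pred A : 'rV[F]_L | predT A && good_approx x.2 (gam x.1) (pad A ord0)]| = #|E x|.
    by apply: eq_card => A; rewrite !inE.
  have := card_nonsingular F xL2.
  have := cardC [pred A : 'rV[F]_L | true && nonsingular x.2 (pad A ord0)].
  rewrite [X in (_ + X)%N](_ : _ = #|[pred A : 'rV[F]_L | ~~ nonsingular x.2 (pad A ord0)]|); last first.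
    by apply: eq_card => A; rewrite !inE.
  move: #|[pred A : 'rV[F]_L | ~~ nonsingular x.2 (pad A ord0)]| => b.
  move: #|[pred A : 'rV[F]_L | true && nonsingular x.2 (pad A ord0)]| => a.
  set t := #|{: 'rV[F]_L}| => eq1 h1 h2.
  have bq : (b * 2 <= t)%N by rewrite (leq_trans _ h1)// leq_mul// card_field_gt1.
  have a'E : (t <= a * 2)%N by lia.
  have aE : (#|E x|%:R : R) = q ^- gam x.1 * a%:R.
    by rewrite -h2 natrM natrX mulrC mulfK// expf_neq0// gt_eqF.
  have w0 : 0 <= q ^- gam x.1 by rewrite invr_ge0 exprn_ge0 ?ler0n.
  rewrite aE [2%:R^-1 * _]mulrC -mulrA; apply/andP; split; apply: ler_wpM2l => //.
    by rewrite ler_pdivrMl ?ltr0n// -natrM ler_nat mulnC.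
  by rewrite ler_nat -/t; lia.
move=> x y /andP[_ Px] /andP[_ Py] xy; have [xy2|xy2|xy2] := ltngtP x.2 y.2.
- exact: card_good_approx_pair.
- rewrite [q ^- gam x.1 * _]mulrC; apply: (le_trans _ (card_good_approx_pair xy2 (xL y) (xL x))).
  by rewrite ler_nat; apply: fintype.subset_leq_card; apply/fintype.subsetP => A; rewrite !inE andbC.
- case/eqP: xy; case: x y Px Py xy2 => [i d] [j e] /= Px Py de.
  have ed : d = e by exact: val_inj.
  rewrite ed in Px *; congr (_, _); apply: val_inj; exact: (dyadic_inj Px Py).
Qed.

(** The events of distinct coprime-headed vectors are exactly pairwise independent. The factor 1/2
    in the weights pays for discarding the vectors with non-coprime head. *)
Lemma hits_2 s J J' (gam : nat -> nat) L : (s.+3 * 2 ^ J' + \sum_(j < J') gam j <= L)%N ->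
  1 <= \sum_(j < J' | (J <= j)%N) 2%:R^-1 * ((2 ^ j) ^ s.+2)%:R / q ^+ gam j ->
  exists2 Q : pred 'M[F]_(s.+2, L), forall A, Q A -> dyadic_hit J J' gam (pad A) &
    8%:R^-1 * #|{: 'M[F]_(s.+2, L)}|%:R <= #|[pred A | Q A]|%:R :> R.
Proof.
move=> JL S1; set n := (2 ^ J')%N.
pose vec := {ffun 'I_s.+2 -> 'rV[F]_n}.
pose D (j : nat) (v : vec) := [forall i, (rVpoly (v i) \is monic) &&
  (2 ^ j < size (rVpoly (v i)) <= 2 ^ j.+1)%N].
pose deg (v : vec) := (\sum_i (size (rVpoly (v i))).-1)%N.
pose P (x : 'I_J' * vec) := (J <= x.1)%N && (D x.1 x.2 && coprime_head x.2).
pose m (x : 'I_J' * vec) := (deg x.2 + gam x.1)%N.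
pose E (x : 'I_J' * vec) (A : 'M[F]_(s.+2, L)) := annihilates (m x) (pad A) (fun i => rVpoly (x.2 i)).
exists (fun A => [exists x, P x && E x A]) => [A /existsP[[j v]]|].
  rewrite /P /E /= => /andP[/and3P[Jj /forallP Dv _] hv].
  exists j, (fun i => rVpoly (v i)); split => // [|i|i]; rewrite ?Jj ?ltn_ord//.
    by case/andP: (Dv i).
  by case/andP: (Dv i).
have sn (v : vec) i : (size (rVpoly (v i)) <= n)%N by exact: size_poly.
have xL (x : 'I_J' * vec) i : (size (rVpoly (x.2 i)) + m x <= L.+1)%N.
  have dn : (deg x.2 <= s.+2 * n)%N.
    rewrite -[in leqRHS](card_ord s.+2) -sum_nat_const; apply: leq_sum => j _.
    by rewrite (leq_trans (leq_pred _)).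
  have := leq_dyadic_gam gam (ltn_ord x.1); have := sn x.2 i; rewrite -/n in JL; rewrite /m; lia.
have cardT x : P x -> #|{: 'M[F]_(s.+2, L)}| = (#|E x| * #|F| ^ m x)%N.
  move=> /andP[_ /andP[/forallP Dx _]]; apply: card_annihilates => //.
  by exists ord0; case/andP: (Dx ord0) => /monic_neq0.
have wE x (a : nat) : (a * #|F| ^ x)%N%:R = a%:R * q ^+ x :> R by rewrite natrM natrX.
have qN0 x : q ^+ x != 0 by rewrite expf_neq0// gt_eqF.
have := @second_moment R 'M[F]_(s.+2, L) _ P E (fun x => q ^- m x) 1.
move=> h; apply: (le_trans _ (h _ _ _ _ _)) => {h}.
- by rewrite expr1n ler_wpM2r ?ler0n//; lra.
- exact: ltr01.
- by move=> x _; rewrite invr_ge0 exprn_ge0 ?ler0n.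
- rewrite (le_trans S1)// /P.
  rewrite -(pair_big_dep (fun j : 'I_J' => (J <= j)%N)
     (fun (j : 'I_J') v => D j v && coprime_head v) (fun j v => q ^- m (j, v))) /=.
  apply: ler_sum => j _.
  (* The vectors are grouped by their degrees. Each of the [(2 ^ j) ^ s.+2] admissible degree
     vectors [d] has at least [q ^ (\sum_i d i) / 2] coprime-headed vectors, of total weight at
     least [q ^- gam j / 2]. *)
  pose dg (v : vec) : {ffun 'I_s.+2 -> 'I_n.+1} := [ffun i => inord (size (rVpoly (v i))).-1].
  rewrite (partition_big dg predT)//=.
  pose dy : pred 'I_n.+1 := [pred d : 'I_n.+1 | (2 ^ j <= d < 2 ^ j.+1)%N].
  have jn : (2 ^ j.+1 <= n)%N by exact: dyadic_lt.
  have -> : 2%:R^-1 * ((2 ^ j) ^ s.+2)%:R / q ^+ gam j =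
      \sum_(d : {ffun 'I_s.+2 -> 'I_n.+1} | d \in ffun_on dy) 2%:R^-1 / q ^+ gam j :> R.
    rewrite sumr_const card_ffun_on card_ord card_dyadic ?(leq_trans jn)//.
    by rewrite -[RHS]mulr_natl mulrAC mulrC mulrA.
  rewrite [leLHS]big_mkcond; apply: ler_sum => d _; case: ifPn => [/ffun_onP dd|_]; last first.
    by apply: sumr_ge0 => v _; rewrite invr_ge0 exprn_ge0 ?ler0n.
  have dn i : (0 < d i < n)%N.
    have := dd i; rewrite inE => /andP[h1 h2].
    by rewrite (leq_trans _ h1) ?expn_gt0//= (leq_trans h2).
  have PE v : ((D j v && coprime_head v) && (dg v == d)) =
      (monic_vector (fun i => val (d i)) v && coprime_head v).
    rewrite andbAC; congr (_ && _); apply/andP/forallP => [[/forallP Dv /eqP <-] i|h].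
      case/andP: (Dv i) => -> /andP[v1 v2]; rewrite ffunE /= inordK; last first.
        by rewrite ltnS (leq_trans (leq_pred _)).
      by rewrite prednK ?eqxx// (leq_ltn_trans _ v1).
    split; last first.
      by apply/eqP/ffunP => i; apply: val_inj; rewrite ffunE /= inordK;
        case/andP: (h i) => _ /eqP -> //=; exact: ltn_ord.
    by apply/forallP => i; have := dd i; rewrite inE; case/andP: (h i) => -> /eqP ->.
  rewrite (eq_bigl _ _ PE) (eq_bigr (fun=> q ^- (\sum_i d i + gam j))); last first.
    move=> v /andP[/forallP h _]; rewrite /m /deg; congr (_ ^- (_ + _)).
    by apply: eq_bigr => i _; case/andP: (h i) => _ /eqP ->.
  rewrite sumr_const exprD invfM -[leRHS]mulr_natl mulrA ler_wpM2r ?invr_ge0 ?exprn_ge0 ?ler0n//.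
  rewrite ler_pdivlMr ?exprn_gt0// ler_pdivrMl ?ltr0n// -natrX -natrM ler_nat.
  have dn' i : (0 < val (d i) < n)%N by exact: dn.
  have hN := @card_noncoprime F n s (fun i => val (d i)) dn'.
  have hM := @card_monic_vector F n _ (fun i => val (d i)) (fun i => (andP (dn' i)).2).
  have hMN : #|[pred v | @monic_vector F n _ (fun i => val (d i)) v]| =
      (#|[pred v | @monic_vector F n _ (fun i => val (d i)) v && coprime_head v]| +
       #|[pred v | @monic_vector F n _ (fun i => val (d i)) v && ~~ coprime_head v]|)%N.
    rewrite -(cardID (@coprime_head F n s)); congr (_ + _)%N.
    by apply: eq_card => v; rewrite !inE andbC.
  rewrite hM in hMN; rewrite hMN in hN *.
  move: hN; move: #|[pred v | _ v && ~~ coprime_head v]| => y.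
  have eqX : #|[pred v | @monic_vector F n _ (fun i => val (d i)) v && coprime_head v]| =
    #|(fun v => @monic_vector F n _ (fun i => val (d i)) v && coprime_head v)| by apply: eq_card.
  rewrite eqX; move: #|(fun v => _ && _)| => x yx.
  by have := leq_mul (leqnn y) card_field_gt1; lia.
- move=> x Px.
  have e : q ^- m x * #|{: 'M[F]_(s.+2, L)}|%:R = #|E x|%:R.
    by rewrite (cardT _ Px) wE mulrC mulfK.
  by rewrite mul1r e lexx.
move=> x y Px Py xy.
have m2 : #|{: 'M[F]_(s.+2, L)}| =
    (#|[pred A : 'M[F]_(s.+2, L) | E x A && E y A]| * #|F| ^ (m x + m y))%N.
  apply: card_annihilates2 => //.
  have [/andP[_ /andP[/forallP Dx cx]] /andP[_ /andP[/forallP Dy cy]]] := (Px, Py).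
  apply: coprime_free => // [i|i|].
  - by case/andP: (Dx i).
  - by case/andP: (Dy i).
  (* The degree of the first entry determines [j], so distinct indices carry distinct vectors. *)
  have xy2 : x.2 != y.2.
    apply: contraNneq xy => e; rewrite [x]surjective_pairing [y]surjective_pairing e.
    apply/eqP; congr (_, _); apply: val_inj.
    apply: (@dyadic_inj _ _ (size (rVpoly (x.2 ord0))).-1).
      by case/andP: (Dx ord0) => _; case: size.
    by rewrite e; case/andP: (Dy ord0) => _; case: size.
  have [i xyi] : exists i, x.2 i != y.2 i.
    apply/existsP; apply: contraNT xy2 => /existsPn h; apply/eqP/ffunP => i.
    by apply/eqP; have := h i; rewrite negbK.
  by exists i; rewrite (inj_eq (can_inj (@rVpolyK F n))).
by rewrite m2 wE exprD -invfM mulrC mulfK// mulf_neq0.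
Qed.

End Hits.

(** * Empty boxes *)

(** Translates the digits of the Kronecker sequence into pairings; only the exponents of [p]
    contribute to the Cauchy product. *)
Lemma frac_partE (F : fieldType) (p : {poly F}) (u : nat -> F) i :
  frac_part (laurent_mul (laurent_poly p) (laurent_frac u)) i = pairing u ('X^i * p).
Proof.
rewrite -pairing_shift /frac_part /= -(fsbig_widen [set - x%:Z | x in `I_(size p)])//; last first.
  move=> a [_ /= na]; case: ifPn => a0; rewrite ?mul0r// nth_default ?mul0r//.
  rewrite leqNgt; apply/negP => ap; apply: na; exists `|a|%N => //.
  by rewrite abszE ler0_norm// opprK.
rewrite (@reindex_fsbig _ _ _ _ _ (fun x : nat => - x%:Z) `I_(size p)); last first.
  split => [x xp|x y _ _ /oppr_inj[]//|_ [x xp <-]]; first by exists x.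
  by exists x.
rewrite -fsbig_ord; apply: eq_bigr => t _ /=.
rewrite oppr_le0 lez_nat leq0n abszN absz_nat opprK.
by rewrite -PoszD addSn.
Qed.

Section Eval.
Variables (R : realType) (q : nat).
Hypothesis pq : prime q.
Implicit Types t : nat -> 'F_q.
Local Notation a t := (fun k => (t k : nat)%:R / q%:R ^+ k.+1 : R).

Let q_gt0 : 0 < q%:R :> R.
Proof. by rewrite ltr0n prime_gt0. Qed.

Let qX_gt0 n : 0 < q%:R ^+ n :> R.
Proof. exact: exprn_gt0. Qed.

Let digit_ge0 t k : 0 <= a t k.
Proof. by rewrite divr_ge0// ltW. Qed.

Let series_nd t : nondecreasing_seq (series (a t)).
Proof.
apply/nondecreasing_seqP => n; rewrite /series /= big_nat_recr//= lerDl.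
exact: digit_ge0.
Qed.

(** Digits are at most [q - 1], and the sum of [(q - 1) * q ^- k.+1] telescopes. *)
Let series_le t e n : series (a t) (e + n)%N <=
  series (a t) e + (q%:R ^- e - q%:R ^- (e + n)).
Proof.
elim: n => [|n IH]; first by rewrite addn0 subrr addr0.
rewrite addnS (_ : series (a t) (e + n).+1 = series (a t) (e + n)%N + a t (e + n)%N); last first.
  by rewrite /series /= big_nat_recr.
have tq : (t (e + n) < q)%N by rewrite -[ltnRHS](Fp_cast pq).
have qE : q%:R ^- (e + n) = q%:R * q%:R ^- (e + n).+1 :> R.
  by rewrite exprS invfM mulrA mulfV ?mul1r// gt_eqF.
have tX : ((t (e + n)).+1%:R : R) * q%:R ^- (e + n).+1 <= q%:R * q%:R ^- (e + n).+1.
  by rewrite ler_pM2r ?invr_gt0// ler_nat.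
rewrite -natr1 mulrDl mul1r -qE in tX; lra.
Qed.

Let series_cvg t : cvgn (series (a t)).
Proof.
apply: nondecreasing_is_cvgn => //; exists 1 => _ [n _ <-].
have := series_le t 0 n; rewrite add0n (_ : series (a t) 0%N = 0); last first.
  by rewrite /series /= big_geq.
rewrite add0r expr0 invr1.
by move=> h; rewrite (le_trans h)// gerBl invr_ge0 ltW.
Qed.

Lemma eval_frac_ge t n : series (a t) n <= eval_frac R t.
Proof. exact: nondecreasing_cvgn_le. Qed.

Lemma eval_frac_le t e : eval_frac R t <= series (a t) e + q%:R ^- e.
Proof.
apply: limr_le => //; exists e => // n /= en.
rewrite -(subnKC en) (le_trans (series_le _ _ _))// lerD2l gerBl.
by rewrite invr_ge0 ltW.
Qed.

Lemma eval_frac_lt_digit t e : eval_frac R t < q%:R ^- e ->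
  forall i, (i < e)%N -> t i = 0.
Proof.
move=> te i ie; apply/eqP; apply: contraTT te => ti; rewrite -leNgt.
apply: (le_trans _ (eval_frac_ge t i.+1)).
rewrite /series /= big_nat_recr//= -[leLHS]add0r lerD//; first exact: sumr_ge0.
have t1 : (1 <= t i)%N by rewrite lt0n.
rewrite (@le_trans _ _ (q%:R ^- i.+1))//.
  rewrite lef_pV2 ?posrE// ler_eXn2l ?ltr1n ?prime_gt1//.
by rewrite ler_pdivlMr// mulVf ?gt_eqF// ler1n.
Qed.

(** The upper bound kills the first [e] digits and gives [t e < 2]. The lower bound excludes
    [t e = 0]: with 3/2 instead of 1 it also rules out the expansion of [q ^- e.+1] whose tail
    digits are all [q - 1]. *)
Lemma eval_frac_itv_digit t e :
  3%:R / 2%:R * q%:R ^- e.+1 <= eval_frac R t < 2%:R * q%:R ^- e.+1 ->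
  (forall i, (i < e)%N -> t i = 0) /\ t e = 1.
Proof.
move=> /andP[h1 h2].
have te : forall i, (i < e)%N -> t i = 0.
  apply: eval_frac_lt_digit; apply: (lt_le_trans h2).
  rewrite exprS invfM mulrA -[leRHS]mul1r ler_pM2r ?invr_gt0//.
  by rewrite ler_pdivrMr// mul1r ler_nat prime_gt1.
split=> //.
have S1 : series (a t) e.+1 = (t e)%:R / q%:R ^+ e.+1.
  rewrite /series /= big_nat_recr//= big_nat big1 ?add0r// => i /andP[_ ie].
  by rewrite te// mul0r.
have t2 : (t e < 2)%N.
  have := le_lt_trans (eval_frac_ge t e.+1) h2.
  by rewrite S1 ltr_pM2r ?invr_gt0// ltr_nat.
have t0 : (0 < t e)%N.
  rewrite lt0n; apply/negP => /eqP te0.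
  have := le_trans h1 (eval_frac_le t e.+1).
  rewrite S1 te0 mul0r add0r -[leRHS]mul1r ler_pM2r ?invr_gt0//; lra.
apply: val_inj; have -> : val (t e) = 1%N by rewrite /=; lia.
by rewrite /= ?Fp_cast// modn_small// prime_gt1.
Qed.

Lemma size_nat_poly m n : (n < q ^ m)%N -> (size (nat_poly q n) <= m)%N.
Proof.
move=> nm; apply/leq_sizeP => i mi; rewrite coef_poly; case: ifP => // _.
by rewrite divn_small ?mod0n// (leq_trans nm)// leq_pexp2l// prime_gt0.
Qed.

Lemma star_discrepancy_ge s (y : nat -> 'I_s -> R) N (x : 'I_s -> R) :
  (forall j, 0 <= x j <= 1) ->
  `|#|[pred n : 'I_N | [forall j, 0 <= y n j < x j]]|%:R - N%:R * \prod_(j < s) x j|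
  <= star_discrepancy y N.
Proof.
move=> x01; apply: ub_le_sup; last by exists x.
exists (N%:R + N%:R) => _ [z z01 <-].
rewrite (le_trans (ler_normB _ _))// lerD//.
  by rewrite normr_nat ler_nat (leq_trans (max_card _))// card_ord.
rewrite normrM normr_nat -[leRHS]mulr1 ler_wpM2l//.
rewrite ger0_norm; last by apply: prodr_ge0 => j _; case/andP: (z01 j).
by apply: prodr_ile1 => j _; exact: z01.
Qed.

(* The digits of each of the first [q ^ m] points satisfy the linear relation
   with coefficient vector [k], which every point of the box
   [3/2 q^-e, 2 q^-e) x prod [0, q^-e_j) would violate; that box is the
   difference of two anchored ones. *)
Lemma discrepancy_annihilates s (f : s.-tuple (fseries q))
    (k : 'I_s -> {poly 'F_q}) m (i0 : 'I_s) :
  (forall i, k i \is monic) -> annihilates m (tnth f : 'I_s -> nat -> 'F_q) k ->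
  q%:R ^+ m / q%:R ^+ (\sum_i size (k i)) / 4%:R <=
  star_discrepancy (digital_kronecker R f) (q ^ m).
Proof.
move=> km /annihilatesP ann; set D := star_discrepancy _ _.
pose x (c : R) (i : 'I_s) : R := (if i == i0 then c else 1) * q%:R ^- size (k i).
have sk i : (0 < size (k i))%N by rewrite size_poly_gt0 monic_neq0.
have x01 c : 0 <= c <= 2%:R -> forall i, 0 <= x c i <= 1.
  move=> /andP[c0 c2] i; rewrite /x; apply/andP; split.
    by rewrite mulr_ge0 ?invr_ge0 ?exprn_ge0 ?ler0n//; case: ifP.
  rewrite ler_pdivrMr// mul1r (@le_trans _ _ 2%:R)//; first by case: ifP => // _; rewrite ler1n.
  rewrite (@le_trans _ _ q%:R) ?ler_nat ?prime_gt1// -natrX ler_nat.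
  by rewrite -[leqLHS]expn1 leq_pexp2l // prime_gt0.
have px c : \prod_i x c i = c * q%:R ^- (\sum_i size (k i)).
  rewrite /x big_split /= -big_mkcond /= big_pred1_eq; congr (_ * _).
  by rewrite prodfV expr_sum.
have dE (n : nat) i (t : nat) :
    frac_part (laurent_mul (laurent_poly (nat_poly q n)) (laurent_frac (tnth f i))) t =
    pairing (tnth f i) ('X^t * nat_poly q n) by exact: frac_partE.
(* In such a point every digit entering the relation [k] vanishes except one, which equals 1 and has
   the leading coefficient 1 of [k i0]; the relation would read [1 = 0]. *)
have empty (n : 'I_(q ^ m)) : ~ ((forall j, 0 <= digital_kronecker R f n j < x 2%:R j) /\
    x (3%:R / 2%:R) i0 <= digital_kronecker R f n i0).
  move=> [h2 h1]; have := ann _ (size_nat_poly (ltn_ord n)).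
  have kE i : pairing (tnth f i) (nat_poly q n * k i) = \sum_(t < size (k i))
      (k i)`_t * pairing (tnth f i) ('X^t * nat_poly q n).
    rewrite -{1}[k i]coefK poly_def mulr_sumr linear_sum; apply: eq_bigr => t _.
    by rewrite -scalerAr linearZ /= mulrC ['X^_ * _]mulrC mulrC.
  rewrite (bigD1 i0)//= big1 ?addr0 => [|i ii0]; last first.
    rewrite kE big1// => t _; rewrite -dE.
    have /andP[_ hi] := h2 i; rewrite /x (negPf ii0) mul1r in hi.
    by rewrite (eval_frac_lt_digit hi)// mulr0.
  have := h2 i0; rewrite /x eqxx in h1 * => /andP[_ hi].
  have sE : size (k i0) = (size (k i0)).-1.+1 by rewrite prednK.
  rewrite kE; rewrite sE in h1 hi *.
  have [z o] := eval_frac_itv_digit (introT andP (conj h1 hi)).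
  rewrite big_ord_recr /= big1 ?add0r => [|t _].
    rewrite -dE o mulr1 -lead_coefE; have := km i0; rewrite monicE => /eqP ->.
    by apply/eqP; rewrite oner_eq0.
  by rewrite -dE z// mulr0.
pose cnt c := #|[pred n : 'I_(q ^ m) | [forall j, 0 <= digital_kronecker R f n j < x c j]]|.
have cntE : cnt 2%:R = cnt (3%:R / 2%:R).
  apply: eq_card => n; rewrite !inE; apply/forallP/forallP => h j.
    have /andP[h0 hj] := h j; rewrite h0 /=.
    case: (eqVneq j i0) => [ji|ji]; last by rewrite /x (negPf ji) in hj *.
    rewrite ji ltNge; apply/negP => h1; by apply: (empty n).
  have /andP[-> hj] := h j; apply: (lt_le_trans hj).
  rewrite /x; case: ifP => // _; rewrite ler_pM2r ?invr_gt0//; lra.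
(* Both anchored boxes contain equally many points, while their expected numbers differ by half of
   [M * V]; one of the two deviations is therefore at least a quarter of it. *)
have b1 := star_discrepancy_ge (digital_kronecker R f) (q ^ m) (x01 2%:R _).
have b2 := star_discrepancy_ge (digital_kronecker R f) (q ^ m) (x01 (3%:R / 2%:R) _).
have {}b1 := b1 ltac:(lra); have {}b2 := b2 ltac:(lra).
rewrite -/D -/(cnt _) !px in b1 b2; rewrite cntE in b1.
move: b1 b2; rewrite !ler_norml natrX; set V := q%:R ^- _; set M := q%:R ^+ m.
rewrite -/(M / _) -/V => /andP[l1 _] /andP[_ u2].
have -> : M / q%:R ^+ (\sum_i size (k i)) = M * V by [].
nra.
Qed.

End Eval.

(** * Divergence and growth *)

Lemma harmonic_tail_unbounded (R : realType) (C : R) J :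
  exists J', C <= \sum_(j < J' | (J <= j)%N) j.+1%:R^-1.
Proof.
apply: contrapT => nC; apply: (@dvg_harmonic R).
apply: nondecreasing_is_cvgn.
  apply/nondecreasing_seqP => n; rewrite /series /= big_nat_recr//= lerDl.
  by rewrite invr_ge0.
exists (C + \sum_(j < J) j.+1%:R^-1) => _ [n _ <-].
rewrite /series /= big_mkord (bigID (fun j : 'I_n => (J <= j)%N)) /= lerD//.
  by apply/ltW; rewrite ltNge; apply/negP => Cn; apply: nC; exists n.
have [nJ|Jn] := leqP n J.
  rewrite [leRHS](bigID (fun j : 'I_J => (j < n)%N)) /= -(big_ord_widen_cond _ xpredT (fun j => j.+1%:R^-1) nJ).
  rewrite -[leLHS]addr0 lerD//; last by apply: sumr_ge0 => j _; rewrite invr_ge0.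
  rewrite [leRHS](bigID (fun j : 'I_n => ~~ (J <= j)%N)) /= lerDl.
  by apply: sumr_ge0 => j _; rewrite invr_ge0.
rewrite (big_ord_widen_cond n xpredT (fun j => j.+1%:R^-1) (ltnW Jn)) /=.
by under [leRHS]eq_bigl do rewrite ltnNge.
Qed.

Section Hits.
Variables (F : finFieldType) (R : realFieldType).

Lemma hits s J J' (gam : nat -> nat) L : (0 < s)%N ->
  (s.+1 * 2 ^ J' + \sum_(j < J') gam j <= L)%N ->
  2%:R <= \sum_(j < J' | (J <= j)%N) ((2 ^ j) ^ s)%:R / #|F|%:R ^+ gam j :> R ->
  exists2 Q : pred 'M[F]_(s, L), forall A, Q A -> dyadic_hit J J' gam (pad A) &
    8%:R^-1 * #|{: 'M[F]_(s, L)}|%:R <= #|[pred A | Q A]|%:R :> R.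
Proof.
case: s => [//|[|s]] _ JL S2.
  apply: hits_1 => //; move: S2; under eq_bigr do rewrite expn1.
  by apply: le_trans; rewrite ler1n.
apply: hits_2 => //; under eq_bigr do rewrite -mulrA.
by rewrite -mulr_sumr ler_pdivlMl// mulr1.
Qed.

(** A hit reads only the first [L] coefficients, which transfers it from a padded block to the
    series itself. *)
Lemma dyadic_hit_eq s J J' (gam : nat -> nat) L (f f' : 'I_s -> nat -> F) :
  (s.+1 * 2 ^ J' + \sum_(j < J') gam j <= L)%N ->
  (forall i t, (t < L)%N -> f i t = f' i t) ->
  dyadic_hit J J' gam f -> dyadic_hit J J' gam f'.
Proof.
move=> JL ff' [j [k [jJ km sk ann]]]; exists j, k; split => //.
rewrite -(annihilates_eq ff')// => i.
case/andP: jJ => _ jJ.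
have jJ' := dyadic_lt jJ.
have kJ i' : (size (k i') <= 2 ^ J')%N.
  by case/andP: (sk i') => _ h; exact: leq_trans jJ'.
have sJ : (\sum_i (size (k i)).-1 <= s * 2 ^ J')%N.
  rewrite -[in leqRHS](card_ord s) -sum_nat_const; apply: leq_sum => i' _.
  by rewrite (leq_trans (leq_pred _)).
rewrite leqW// (leq_trans _ JL)// addnA mulSn.
exact: leq_add (leq_add (kJ i) sJ) (leq_dyadic_gam gam jJ).
Qed.

End Hits.

Section Growth.
Variables (q s : nat).
Hypotheses (q_gt1 : (1 < q)%N) (s_gt0 : (0 < s)%N).

(* [q ^ gap j] is of order [n ^ s * log n] for [n = 2 ^ j], and there are
   [n ^ s] vectors of degrees in the [j]-th dyadic range: the weights sum up to a
   multiple of the harmonic series. *)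
Definition gap j := up_log q ((2 ^ j) ^ s * j.+1).

Lemma gap_ge j : ((2 ^ j) ^ s * j.+1 <= q ^ gap j)%N.
Proof. exact: up_logP. Qed.

Lemma gap_le j : (0 < j)%N -> (q ^ gap j <= q * ((2 ^ j) ^ s * j.+1))%N.
Proof.
move=> j0; have X1 : (1 < (2 ^ j) ^ s * j.+1)%N.
  by rewrite (@leq_trans j.+1)// leq_pmull// !expn_gt0.
have := up_log_gtn q_gt1 X1; rewrite -/(gap j) => h.
apply: (@leq_trans (q * q ^ (gap j).-1)%N); last by rewrite leq_mul2l ltnW ?orbT.
by rewrite -expnS leq_exp2l// leqSpred.
Qed.

(** A crude bound, sufficient to keep the total number of conditions of order [2 ^ j]. *)
Lemma gap_small j : (gap j <= s.+1 * 2 ^ j)%N.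
Proof.
have jj : (j.+1 <= 2 ^ j)%N by exact: ltn_expl.
apply: (@leq_trans (s.+1 * j)); last by rewrite leq_mul2l ltnW ?orbT.
apply: up_log_min => //; apply: (@leq_trans (2 ^ (s.+1 * j))); last first.
  by case: (posnP (s.+1 * j)) => [->//|e0]; rewrite leq_exp2r.
by rewrite mulSn expnD mulnC leq_mul// -expnM mulnC.
Qed.

End Growth.

(** With [x = ln (q ^ m)], one has [x <= m q <= K 2 ^ j], and then [ln x <= K + j <= K (j + 1)];
    these two bounds use up the power [K ^ s.+1]. *)
Lemma ln_growth (R : realType) (s q m K j : nat) : (1 < q)%N -> (0 < m)%N -> (0 < K)%N ->
  (m * q <= K * 2 ^ j)%N ->
  (4%:R * K%:R ^+ s.+1)^-1 * ln ((q ^ m)%:R : R) ^+ s * ln (ln ((q ^ m)%:R : R)) <=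
  ((2 ^ j) ^ s * j.+1)%:R / 4%:R.
Proof.
move=> q1 m0 K0 mK; set x := ln _.
have q0 : 0 < q%:R :> R by rewrite ltr0n ltnW.
have x0 : 0 < x.
  by rewrite ln_gt0// ltr1n (leq_trans q1)// -[leqLHS]expn1 leq_pexp2l// ltnW.
have xK : x <= K%:R * 2%:R ^+ j.
  rewrite /x natrX lnXn// -natrX -natrM; apply: le_trans (_ : (m * q)%:R <= _).
    by rewrite -[leLHS]mulr_natl natrM ler_wpM2l//; apply/ltW/ln_sublinear.
  by rewrite ler_nat.
have K1 : 1 <= K%:R :> R by rewrite ler1n.
have lx : ln x <= K%:R * j.+1%:R.
  apply: (@le_trans _ _ (ln ((2 ^ (K + j))%:R : R))).
    rewrite ler_ln ?posrE ?ltr0n ?expn_gt0//; apply: (le_trans xK).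
    by rewrite -natrX -natrM ler_nat expnD leq_mul2r ltnW ?orbT// ltn_expl.
  rewrite natrX lnXn ?ltr0n// -[leLHS]mulr_natl.
  apply: (@le_trans _ _ ((K + j)%:R * 1)).
    rewrite ler_wpM2l// -[leRHS](@expRK R) ler_ln ?posrE ?expR_gt0 ?ltr0n//.
    exact: expR_ge1Dx.
  by rewrite mulr1 -natrM ler_nat; nia.
have c0 : 0 <= (4%:R * K%:R ^+ s.+1)^-1 :> R by rewrite invr_ge0 mulr_ge0 ?exprn_ge0.
apply: (@le_trans _ _ ((4%:R * K%:R ^+ s.+1)^-1 * x ^+ s * (K%:R * j.+1%:R))).
  by rewrite ler_wpM2l// mulr_ge0// exprn_ge0// ltW.
apply: (@le_trans _ _ ((4%:R * K%:R ^+ s.+1)^-1 * (K%:R * 2%:R ^+ j) ^+ s * (K%:R * j.+1%:R))).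
  rewrite ler_wpM2r ?mulr_ge0// ler_wpM2l// lerXn2r// nnegrE ?ltW//.
  by rewrite mulr_gt0 ?exprn_gt0 ?ltr0n.
rewrite exprMn natrM !natrX exprS le_eqVlt; apply/orP; left; apply/eqP.
by field; rewrite expf_neq0 ?pnatr_eq0 -?lt0n ?K0//= pnatr_eq0 -lt0n.
Qed.

(** * Blocks of coefficients *)

Definition prefix (F : fieldType) s L (f : 'I_s -> nat -> F) : 'M[F]_(s, L) :=
  \matrix_(i, t) f i t.

Section Cylinders.
Variables (R : realType) (q s : nat).
Hypothesis pq : prime q.
Local Notation F := 'F_q.
Local Notation mu := (haar_prod R q s).

(** The set is a finite disjoint union of cylinders of equal measure, so finite counting computes
    Haar measure. *)
Lemma haar_prod_prefix L (Q : pred 'M[F]_(s, L)) :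
  measurable [set f : s.-tuple (fseries q) | Q (prefix L (tnth f : 'I_s -> nat -> F))] /\
  mu [set f | Q (prefix L (tnth f : 'I_s -> nat -> F))] =
  (#|[pred A | Q A]|%:R / #|{: 'M[F]_(s, L)}|%:R)%:E.
Proof.
pose cyl (A : 'M[F]_(s, L)) j : set (fseries q) :=
  [set g | forall t, (t < L)%N -> g t = pad A j t].
pose box A := [set f : s.-tuple (fseries q) | forall j, cyl A j (tnth f j)].
have mcyl A j : measurable (cyl A j) by exact: measurable_cylinder.
have mbox A : measurable (box A) by exact: measurable_box.
have boxE A f : box A f <-> prefix L (tnth f : 'I_s -> nat -> F) = A.
  split => [h|<- j t tL]; last by rewrite (padE _ _ tL) mxE.
  by apply/matrixP => i t; rewrite mxE h// (padE _ _ (ltn_ord t)); congr (A i _); exact: val_inj.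
have mubox A : mu (box A) = (#|{: 'M[F]_(s, L)}|%:R^-1)%:E.
  rewrite /box haar_prodE// (eq_bigr (fun=> (q%:R ^- L)%:E)); last first.
    by move=> j _; exact: haar_cylinder.
  rewrite prodEFin prodr_const card_ord card_mx card_Fp// natrX exprVn.
  by rewrite -exprM mulnC.
have -> : [set f | Q (prefix L (tnth f : 'I_s -> nat -> F))] =
    \bigcup_(A in [set` enum [pred A | Q A]]) box A.
  apply/seteqP; split => f /=.
    by move=> Qf; exists (prefix L (tnth f)); [rewrite /= mem_enum|exact/boxE].
  by move=> [A /=]; rewrite mem_enum => QA /boxE ->.
have fin : finite_set [set` enum [pred A | Q A]] by exact: finite_seq.
split; first exact: fin_bigcup_measurable.
rewrite measure_fin_bigcup//; last first.
  by move=> A A' _ _ [f [/boxE <- /boxE <-]].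
rewrite -fsbig_seq ?enum_uniq// (eq_bigr _ (fun A _ => mubox A)) sumEFin.
by rewrite big_enum /= sumr_const mulr_natl.
Qed.

Lemma card_row_mx (L1 L2 : nat) (P1 : pred 'M[F]_(s, L1)) (P2 : pred 'M[F]_(s, L2)) :
  #|[pred A : 'M[F]_(s, L1 + L2) | P1 (lsubmx A) && P2 (rsubmx A)]| =
  (#|[pred A | P1 A]| * #|[pred A | P2 A]|)%N.
Proof.
rewrite -cardX.
pose h (x : 'M[F]_(s, L1) * 'M[F]_(s, L2)) := row_mx x.1 x.2.
have hI : injective h by move=> [a b] [c d] /eq_row_mx[/= -> ->].
rewrite -(fintype.card_image hI); apply: eq_card => A; apply/idP/fintype.imageP => [h12|[[a b] hab ->]].
  exists (lsubmx A, rsubmx A); last by rewrite /h /= hsubmxK.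
  by rewrite !inE in h12 *.
by move: hab; rewrite !inE /h /= row_mxKl row_mxKr.
Qed.

(* Block after block of coefficients, the part of [Bad] not yet excluded loses a
   fixed proportion of its measure. *)
Lemma negligible_blocks (Bad : set (s.-tuple (fseries q))) :
  (forall M, exists L (Q : pred 'M[F]_(s, L)),
    8%:R^-1 * #|{: 'M[F]_(s, L)}|%:R <= #|[pred A | Q A]|%:R :> R /\
    forall f, Q (prefix L (fun i t => (tnth f i : nat -> F) (M + t)%N)) -> ~ Bad f) ->
  mu.-negligible Bad.
Proof.
move=> block.
(* [S] is the set of prefixes not excluded after [n] blocks. The next block starts at [M] and leaves
   at most 7/8 of the extensions of each prefix. *)
have step n : exists M (S : pred 'M[F]_(s, M)),
    (forall f, Bad f -> S (prefix M (tnth f : 'I_s -> nat -> F))) /\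
    #|[pred A | S A]|%:R <= (7%:R / 8%:R) ^+ n * #|{: 'M[F]_(s, M)}|%:R :> R.
  elim: n => [|n [M [S [BS cS]]]].
    exists 0%N, predT; split=> //; rewrite mul1r ler_nat; exact: max_card.
  have [L [Q [cQ QB]]] := block M.
  exists (M + L)%N, (fun A => S (lsubmx A) && ~~ Q (rsubmx A)); split => [f Bf|].
    have -> : lsubmx (prefix (M + L) (tnth f : 'I_s -> nat -> F)) = prefix M (tnth f : 'I_s -> nat -> F).
      by apply/matrixP => i t; rewrite !mxE.
    have -> : rsubmx (prefix (M + L) (tnth f : 'I_s -> nat -> F)) =
        prefix L (fun i t => (tnth f i : nat -> F) (M + t)%N).
      by apply/matrixP => i t; rewrite !mxE.
    by rewrite BS//=; apply/negP => /QB.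
  rewrite (card_row_mx S (fun A => ~~ Q A)) natrM.
  have -> : #|{: 'M[F]_(s, M + L)}| = (#|{: 'M[F]_(s, M)}| * #|{: 'M[F]_(s, L)}|)%N.
    by rewrite !card_mx mulnDr expnD.
  have cNQ : #|[pred A | ~~ Q A]|%:R <= 7%:R / 8%:R * #|{: 'M[F]_(s, L)}|%:R :> R.
    have : (#|[pred A | Q A]| + #|[pred A | ~~ Q A]|)%:R = #|{: 'M[F]_(s, L)}|%:R :> R.
      by rewrite -(cardC [pred A | Q A]); congr (_ + _)%:R; apply: eq_card => A; rewrite !inE.
    by rewrite natrD => hs; lra.
  rewrite exprSr natrM mulrACA; exact: ler_pM.
have pack n : exists S : set (s.-tuple (fseries q)),
    [/\ measurable S, Bad `<=` S & (mu S <= ((7%:R / 8%:R) ^+ n)%:E)%E].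
  have [M [S [BS cS]]] := step n.
  have [mS muS] := haar_prod_prefix S.
  exists [set f | S (prefix M (tnth f : 'I_s -> nat -> F))]; split => //.
  rewrite muS lee_fin ler_pdivrMr// ltr0n card_mx expn_gt0.
  by rewrite (cardD1 0) inE.
have [S SP] := choice pack.
have mS : measurable (\bigcap_n S n) by apply: bigcap_measurable => // n _; case: (SP n).
exists (\bigcap_n S n); split => //; last by move=> f Bf n _; case: (SP n) => _ h _; exact: h.
(* The intersection of all these measurable covers has measure below every power of 7/8. *)
have le n : (mu (\bigcap_n S n) <= ((7%:R / 8%:R) ^+ n)%:E)%E.
  have [mSn _] := SP n; apply: le_trans; apply: le_measure; rewrite ?inE//.
  exact: bigcap_inf.
have fin := fin_num_measure mu _ mS.
have r0 : fine (mu (\bigcap_n S n)) <= 0.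
  have z1 : `|7%:R / 8%:R : R| < 1 by rewrite ger0_norm; lra.
  have <- : limn (GRing.exp (7%:R / 8%:R) : R^nat) = 0 by apply/cvg_lim => //; exact: cvg_expr.
  apply: limr_ge; first by apply: cvgP; exact: cvg_expr.
  by apply: nearW => n; rewrite -lee_fin fineK.
by apply/eqP; rewrite -measure_le0 -(fineK fin) lee_fin.
Qed.

End Cylinders.

(** * Assembling the lower bound *)

(** A hit for the shifted series gives an annihilated vector for [f] itself, and hence an empty box
    among the first [q ^ m] points. The summand [s * M + s] of the excess pays for the factor ['X^M]
    and for sizes exceeding degrees by one. *)
Lemma dyadic_hit_discrepancy (R : realType) s q M J J' (f : s.-tuple (fseries q)) :
  prime q -> (0 < s)%N -> (M <= 2 ^ J)%N ->
  dyadic_hit J J' (fun j => s * M + s + gap q s j)%N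
    (fun i t => (tnth f i : nat -> 'F_q) (M + t)%N) ->
  exists2 N : nat, (2 ^ J <= N)%N &
    (4%:R * (5 * s * q)%:R ^+ s.+1)^-1 * ln (N%:R : R) ^+ s * ln (ln (N%:R : R)) <=
    star_discrepancy (digital_kronecker R f) N.
Proof.
move=> pq s0 MJ [j [k [/andP[Jj _] km sk ann]]].
have q1 := prime_gt1 pq.
have Jj2 : (2 ^ J <= 2 ^ j)%N by rewrite leq_exp2l.
pose i0 : 'I_s := Ordinal s0.
pose k' i := 'X^M * k i.
have sk' i : size (k' i) = (size (k i) + M)%N.
  by rewrite size_monicM ?monicXn ?monic_neq0// size_polyXn addSn /= addnC.
have sS : (\sum_i size (k' i) = \sum_i (size (k i)).-1 + (s * M + s))%N.
  under eq_bigr do rewrite sk'.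
  rewrite big_split /= sum_nat_const card_ord.
  have -> : (\sum_i size (k i) = \sum_i ((size (k i)).-1 + 1))%N.
    by apply: eq_bigr => i _; rewrite addn1 prednK// size_poly_gt0 monic_neq0.
  by rewrite big_split /= sum_nat_const card_ord muln1 -addnA [(s + _)%N]addnC.
set m := (_ + (_ + gap q s j))%N in ann.
have mE : m = (\sum_i size (k' i) + gap q s j)%N by rewrite sS /m addnA.
have ann' : annihilates m (tnth f : 'I_s -> nat -> 'F_q) k'.
  by rewrite -annihilates_shift.
have k'm i : k' i \is monic by rewrite monicMl ?monicXn.
have m0 : (2 ^ j < m)%N.
  rewrite mE (bigD1 i0)//= sk'; case/andP: (sk i0) => h _.
  by rewrite (leq_trans h)// -!addnA leq_addr.
exists (q ^ m)%N.
  by rewrite (leq_trans Jj2)// (leq_trans (ltnW m0))// ltnW// ltn_expl.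
(* Each [k' i] has size at most [2 ^ j.+1 + M <= 3 * 2 ^ j], and the gap is at most [s.+1 * 2 ^ j];
   since [s >= 1], the sum is at most [5 s 2 ^ j]. *)
have mK : (m * q <= 5 * s * q * 2 ^ j)%N.
  have : (m <= 5 * s * 2 ^ j)%N.
    have hS : (\sum_i size (k' i) <= s * (3 * 2 ^ j))%N.
      rewrite -[in leqRHS](card_ord s) -sum_nat_const; apply: leq_sum => i _.
      rewrite sk'; case/andP: (sk i) => _ h.
      rewrite (_ : 3 * 2 ^ j = 2 ^ j.+1 + 2 ^ j)%N; last by rewrite expnS; lia.
      by rewrite leq_add// (leq_trans MJ).
    rewrite mE; apply: (leq_trans (leq_add hS (gap_small s q1 j))).
    by have := expn_gt0 2 j; move: (2 ^ j)%N => x; nia.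
  by move=> h; rewrite -[leqRHS]mulnAC leq_mul2r h orbT.
have K0 : (0 < 5 * s * q)%N by rewrite !muln_gt0 s0 (prime_gt0 pq).
apply: (le_trans (ln_growth R s q1 (leq_ltn_trans (leq0n _) m0) K0 mK)).
apply: (le_trans _ (discrepancy_annihilates R pq i0 k'm ann')).
rewrite ler_pM2r ?invr_gt0 ?ltr0n// mE exprD mulrAC mulfV ?mul1r; last first.
  by rewrite expf_neq0// pnatr_eq0 -lt0n prime_gt0.
by rewrite -natrX ler_nat gap_ge.
Qed.

(** By [gap_le], which requires [j > 0], each weight is at least [1 / (C (j + 1))] with [C]
    depending on [M] but not on [j]; the harmonic series does the rest. *)
Lemma dyadic_weight_unbounded (R : realType) q s M J : (1 < q)%N -> (0 < s)%N -> (0 < J)%N ->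
  exists J', 2%:R <= \sum_(j < J' | (J <= j)%N)
    ((2 ^ j) ^ s)%:R / q%:R ^+ (s * M + s + gap q s j)%N :> R.
Proof.
move=> q1 s0 J0.
pose C : R := q%:R ^+ (s * M + s).+1.
have C0 : 0 < C by rewrite exprn_gt0// ltr0n ltnW.
have [J' hJ'] := harmonic_tail_unbounded (2%:R * C) J.
exists J'; rewrite -ler_pdivlMr// in hJ'; apply: (le_trans hJ').
rewrite mulr_suml; apply: ler_sum => j Jj.
rewrite -invfM ler_pdivlMr ?exprn_gt0 ?ltr0n ?(ltnW q1)//.
rewrite mulrC ler_pdivrMr ?mulr_gt0//.
rewrite /C -!natrX -!natrM ler_nat expnD expnS.
have := gap_le s q1 (leq_trans J0 Jj).
move: (q ^ gap q s j)%N ((2 ^ j) ^ s)%N (q ^ (s * M + s))%N => G X P h.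
apply: (leq_trans (leq_mul (leqnn P) h)); rewrite eq_leq//; ring.
Qed.

Theorem theorem2 (R : realType) (s q : nat) (s_gt0 : (0 < s)%N)
    (q_prime : prime q) :
  exists2 c : R, 0 < c &
    {ae haar_prod R q s, forall f : s.-tuple (fseries q),
      infinite_set [set N : nat |
        c * ln (N%:R : R) ^+ s * ln (ln (N%:R : R)) <=
        star_discrepancy (digital_kronecker R f) N]}.
Proof.
have q1 := prime_gt1 q_prime.
(* The 4 comes from the difference of two boxes, and [5 * s * q] from the bound on [m * q]. *)
exists (4%:R * (5 * s * q)%:R ^+ s.+1)^-1.
  by rewrite invr_gt0 mulr_gt0 ?ltr0n// exprn_gt0// ltr0n !muln_gt0 s_gt0 (prime_gt0 q_prime).
set c := _^-1.
(* The exceptional set is the countable union over [N0] of the series for which the bound fails at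
   every [N >= N0]. *)
pose Bad N0 := [set f : s.-tuple (fseries q) | forall N, (N0 <= N)%N ->
  ~ (c * ln (N%:R : R) ^+ s * ln (ln (N%:R : R)) <= star_discrepancy (digital_kronecker R f) N)].
apply: (@negligibleS _ _ _ _ (\bigcup_N0 Bad N0)).
  move=> f /= /contrapT /finite_seqP[X XE].
  exists (\max_(N <- X) N).+1%N => // N XN hN.
  have : [set` X] N by rewrite -XE.
  move=> /= NX; have := @leq_bigmax_seq _ X xpredT (fun n => n) N NX isT.
  by rewrite leqNgt XN.
apply: negligible_bigcup => N0; apply: negligible_blocks => // M.
(* This makes [2 ^ J] exceed both [M], so that the factor ['X^M] is harmless, and [N0], so that the
   [N] obtained contradicts [Bad N0]; it also makes [J] positive. *)
pose J := (M + N0).+1.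
have [J' S2] := @dyadic_weight_unbounded R q s M J q1 s_gt0 isT.
pose gam j := (s * M + s + gap q s j)%N.
pose L := (s.+1 * 2 ^ J' + \sum_(j < J') gam j)%N.
have [|Q QJ cQ] := @hits 'F_q R s J J' gam L s_gt0 (leqnn _); first by rewrite card_Fp.
exists L, Q; split=> // f /QJ hit Bf.
have {}hit := dyadic_hit_eq (leqnn L) _ hit.
have [] := @dyadic_hit_discrepancy R s q M J J' f q_prime s_gt0.
- by rewrite (leq_trans _ (ltnW (ltn_expl _ _)))// /J -addnS leq_addr.
- by apply: hit => i t tL; rewrite (padE _ _ tL) mxE.
move=> N JN; apply: Bf; rewrite (leq_trans _ JN)//.
by rewrite (leq_trans _ (ltnW (ltn_expl _ _)))// /J -addSn leq_addl.
Qed.
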